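(* Let $0<p\le\infty$ (with $1/\infty:=0$). (i) There is a positive real number $C_p$ depending only on $p$ such that for all integers $n\ge 2$ and all integers $0\le m\le n-1$, $$\sigma_m^{p,\infty}(\mu_p)\le C_p\left[\frac{\log\left(\frac{en}{m+1}\right)}{n}\right]^{1/p}.$$ (ii) There are numbers $0<\varepsilon_p<1$ and $C_p>0$, depending only on $p$, such that for all integers $n\ge 2$ and all integers $m$ with $0\le m\le \varepsilon_p n$, $$\sigma_m^{p,\infty}(\mu_p)\ge C_p\left[\frac{\log\left(\frac{en}{m+1}\right)}{n}\right]^{1/p}.$$
   Context: Let $\mathbb{R}_+=[0,\infty)$. For $0<p<\infty$ let $\Delta_p^n=\{(t_1,\dots,t_n)\in\mathbb{R}_+^n:\sum_{j=1}^n t_j^p=1\}$, and let $\Delta_\infty^n=\{(t_1,\dots,t_n)\in\mathbb{R}_+^n:\max_{j}t_j=1\}$. For $I\subset\mathbb{R}$ and $A\subset\mathbb{R}^n$ write $I\cdot A=\{tx:t\in I,x\in A\}$; $\lambda$ is Lebesgue measure on $\mathbb{R}^n$. The normalized cone measure $\mu_p$ on $\Delta_p^n$ is the Borel probability measure $$\mu_p(\mathcal{A})=\frac{\lambda([0,1]\cdot\mathcal{A})}{\lambda([0,1]\cdot\Delta_p^n)},\quad \mathcal{A}\subset\Delta_p^n.$$ For $x\in\mathbb{R}^n$ and $0<q\le\infty$, the best $m$-term approximation error is $\sigma_m(x)_q=\inf\{\|x-y\|_q: y\in\mathbb{R}^n \text{ has at most } m \text{ nonzero coordinates}\}$, where $\|x\|_q=(\sum_j|x_j|^q)^{1/q}$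 for $q<\infty$ and $\|x\|_\infty=\max_j|x_j|$. For a Borel probability measure $\mu$ on $\Delta_p^n$ and $0<p\le q\le\infty$, the average surface best $m$-term width is $\sigma_m^{p,q}(\mu)=\int_{\Delta_p^n}\sigma_m(x)_q\,d\mu(x)$. Here $\log$ is the natural logarithm. *)

(* Defs.v *)
(* R^n is n.-tuple R; its sigma-algebra, generated by the coordinate maps, is
   the Borel one. *)
From HB Require Import structures.
From mathcomp Require Import all_boot all_order all_algebra.
From mathcomp Require Import all_classical all_reals all_analysis.
From mathcomp Require Import measurable_realfun.
Set Implicit Arguments.
Unset Strict Implicit.
Unset Printing Implicit Defensive.
Import Order.TTheory GRing.Theory Num.Theory.
Import numFieldNormedType.Exports.

Local Open Scope classical_set_scope.
Local Open Scope ring_scope.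

Section lebesgue_tuple.
Context {R : realType}.

Definition tuple_of_pair n (u : R * n.-tuple R) : n.+1.-tuple R :=
  [tuple of u.1 :: u.2].

(* n-dimensional Lebesgue measure, as an iterated product measure;
   lebesgue_tuple_box gives the volume of boxes. *)
Fixpoint lebesgue_tuple n : set (n.-tuple R) -> \bar R :=
  match n with
  | 0 => \d_([tuple] : 0.-tuple R)
  | n'.+1 => pushforward (@lebesgue_measure R \x @lebesgue_tuple n')%E
      (@tuple_of_pair n')
  end.

Lemma measurable_tuple_of_pair n :
  measurable_fun [set: R * n.-tuple R] (@tuple_of_pair n).
Proof. by apply: measurable_cons. Qed.

Let is_sigma_finite_measure n (mu : set (n.-tuple R) -> \bar R) :=
  [/\ mu set0 = 0%E, forall A, (0 <= mu A)%E, semi_sigma_additive mu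
    & sigma_finite setT mu].

Let lebesgue_tuple_sfm n : is_sigma_finite_measure (@lebesgue_tuple n).
Proof.
elim: n => [|n [mu0 mu_ge0 mu_sadd mu_sf]].
  split; [exact: measure0|exact: measure_ge0| |exact: sigma_finiteT].
  exact: measure_semi_sigma_additive.
pose b := isMeasure.Build _ _ _ (@lebesgue_tuple n) mu0 mu_ge0 mu_sadd.
pose m0 : {measure set (n.-tuple R) -> \bar R} :=
  HB.pack (@lebesgue_tuple n) b.
pose s := Measure_isSigmaFinite.Build _ _ _ (m0 : set _ -> \bar R) mu_sf.
pose mu : {sigma_finite_measure set (n.-tuple R) -> \bar R} :=
  HB.pack (m0 : set _ -> \bar R) m0 s.
pose nu := measure_function_pushforward__canonical__measure_function_Measure
  (@lebesgue_measure R \x mu)%E (@measurable_tuple_of_pair n).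
have nuE : @lebesgue_tuple n.+1 = nu by [].
rewrite nuE; split; [exact: measure0|exact: measure_ge0| |].
  exact: measure_semi_sigma_additive.
have /sigma_finiteP[F [TF ndF Foo]] := sigma_finiteT (@lebesgue_measure R).
have /sigma_finiteP[G [TG ndG Goo]] := sigma_finiteT mu.
pose H k := [set x : n.+1.-tuple R | F k (thead x) /\ G k [tuple of behead x]].
have preH k : @tuple_of_pair n @^-1` H k = F k `*` G k.
  apply/seteqP; split => -[x y]; rewrite /H /= theadE;
    by rewrite (_ : [tuple of _] = y)//; exact: val_inj.
exists H.
  rewrite predeqE => x; split=> // _.
  have [i _ Fi] : (\bigcup_i F i) (thead x) by rewrite -TF.
  have [j _ Gj] : (\bigcup_i G i) [tuple of behead x] by rewrite -TG.
  exists (maxn i j) => //; split.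
    by move: Fi; exact/subsetPset/ndF/leq_maxl.
  by move: Gj; exact/subsetPset/ndG/leq_maxr.
move=> k; have [? ?] := Foo k; have [? ?] := Goo k; split.
  rewrite (_ : H k = (fun x : n.+1.-tuple R => tnth x ord0) @^-1` F k `&`
     (fun x : n.+1.-tuple R => [tuple of behead x] : n.-tuple R) @^-1` G k) //.
  apply: measurableI; rewrite -[X in measurable X]setTI.
    exact: measurable_tnth.
  exact: measurable_behead.
have -> : nu (H k) = (@lebesgue_measure R \x mu)%E (F k `*` G k).
  by rewrite -preH.
rewrite product_measure1E// lte_mul_pinfty//.
by rewrite ge0_fin_numE.
Qed.

HB.instance Definition _ n :=
  let: And4 m0 m_ge0 m_sadd _ := lebesgue_tuple_sfm n in
  isMeasure.Build _ _ _ (@lebesgue_tuple n) m0 m_ge0 m_sadd.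

HB.instance Definition _ n :=
  let: And4 _ _ _ m_sf := lebesgue_tuple_sfm n in
  Measure_isSigmaFinite.Build _ _ _ (@lebesgue_tuple n) m_sf.

Lemma lebesgue_tuple_box n (A : 'I_n -> set R) :
  (forall i, measurable (A i)) ->
  lebesgue_tuple [set x | forall i, A i (tnth x i)] =
  (\prod_(i < n) lebesgue_measure (A i))%E.
Proof.
elim: n A => [|n IH] A mA.
  by rewrite big_ord0 /= diracE mem_set//= => -[].
pose B := [set x : n.-tuple R | forall i, A (lift ord0 i) (tnth x i)].
have mB : measurable B.
  rewrite (_ : B = \bigcap_(i in [set: 'I_n])
      ((fun x : n.-tuple R => tnth x i) @^-1` A (lift ord0 i))); last first.
    by apply/seteqP; split => x /= h i; [move=> _|]; exact: h.
  apply: fin_bigcap_measurable => // i _.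
  by rewrite -[X in measurable X]setTI; exact: measurable_tnth.
rewrite big_ord_recl -IH; last by move=> i; exact: mA.
rewrite -[X in (_ * X)%E]/(lebesgue_tuple B).
rewrite -(@product_measure1E _ _ _ _ _ lebesgue_measure (@lebesgue_tuple n)
  _ _ (mA ord0) mB).
rewrite [LHS]/= /pushforward; congr (_ _); apply/seteqP; split => -[x y] /=.
  move=> xA; split; first by have := xA ord0.
  by move=> i; have := xA (lift ord0 i); rewrite tnthS.
move=> [xA yA] i; have [j ->|->//] := unliftP ord0 i.
by rewrite tnthS.
Qed.

End lebesgue_tuple.

Section lp.
Context {R : realType}.
Implicit Types (p q : \bar R) (n m : nat).

(* Meaningful for 0 < q only. *)
Definition lp_norm q n (x : n.-tuple R) : R :=
  match q with
  | r%:E => (\sum_(i < n) `|tnth x i| `^ r) `^ r^-1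
  | +oo%E => \big[Num.max/0]_(i < n) `|tnth x i|
  | -oo%E => 0
  end.

(* Nonnegative part of the unit lp-sphere, meaningful for 0 < p only. *)
Definition lp_sphere_pos p n : set (n.-tuple R) :=
  [set t | (forall i, 0 <= tnth t i) /\
    match p with
    | r%:E => \sum_(i < n) tnth t i `^ r = 1
    | +oo%E => \big[Num.max/0]_(i < n) tnth t i = 1
    | -oo%E => False
    end].
Arguments lp_sphere_pos p n : clear implicits.

Definition tuple_scale n (t : R) (x : n.-tuple R) : n.-tuple R :=
  [tuple t * tnth x i | i < n].

Definition dilation n (I : set R) (A : set (n.-tuple R)) : set (n.-tuple R) :=
  [set tuple_scale t x | t in I & x in A].

(* The normalized cone measure of the sphere, as a measure on the whole of R^n
   that is carried by the sphere. The proof of 0 < p is not used by the formula;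
   it makes the measure instance below inferable. *)
Definition cone_measure p (_ : (0 < p)%E) n (A : set (n.-tuple R)) : \bar R :=
  (lebesgue_tuple (dilation `[0%R, 1%R] (A `&` lp_sphere_pos p n)) /
   lebesgue_tuple (dilation `[0%R, 1%R] (lp_sphere_pos p n)))%E.

(* The set is nonempty (y = 0) and bounded below by 0, so inf is the actual
   infimum. *)
Definition best_approx q n m (x : n.-tuple R) : R :=
  inf [set lp_norm q [tuple tnth x i - tnth y i | i < n] |
    y in [set y : n.-tuple R | (#|[pred i | tnth y i != 0%R]| <= m)%N]].

Definition avg_width p q n m (mu : {measure set (n.-tuple R) -> \bar R}) :
    \bar R :=
  (\int[mu]_(x in lp_sphere_pos p n) (best_approx q m x)%:E)%E.

Lemma lp_norm_ge0 q n (x : n.-tuple R) : 0 <= lp_norm q x.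
Proof. by case: q => [r||]//=; [exact: powR_ge0|exact: bigmax_ge_id]. Qed.

Section cone.
Variable p : \bar R.
Hypothesis p0 : (0 < p)%E.

Lemma lp_sphere_posE n :
  lp_sphere_pos p n = [set t | (forall i, 0 <= tnth t i) /\ lp_norm p t = 1].
Proof.
apply/seteqP; split=> t [t0]; rewrite /lp_sphere_pos/= => H; split=> //.
- case: p p0 H => [r r0||//]/=; last first.
    by move=> _ <-; apply: eq_bigr => i _; rewrite ger0_norm.
  by move=> H; under eq_bigr do rewrite ger0_norm//; rewrite H powR1.
- case: p p0 H => [r r0||//]/=; last first.
    by move=> _ <-; apply: eq_bigr => i _; rewrite ger0_norm.
  under eq_bigr do rewrite ger0_norm//.
  move/(congr1 (fun z => z `^ r)); rewrite -powRrM mulVf ?gt_eqF//.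
  by rewrite powRr1 ?powR1//; apply: sumr_ge0 => i _; exact: powR_ge0.
Qed.

Lemma lp_normZ n t (x : n.-tuple R) : 0 <= t ->
  lp_norm p (tuple_scale t x) = t * lp_norm p x.
Proof.
move=> t0; case: p p0 => [r r0||//]/=.
  under eq_bigr do rewrite tnth_mktuple normrM powRM// (ger0_norm t0).
  rewrite -mulr_sumr powRM ?powR_ge0//; last first.
    by apply: sumr_ge0 => i _; exact: powR_ge0.
  by rewrite -powRrM mulfV ?gt_eqF// powRr1.
move=> _; under eq_bigr do rewrite tnth_mktuple normrM (ger0_norm t0).
elim/big_rec2: _ => [|i y1 y2 _ ->]; first by rewrite mulr0.
by rewrite maxr_pMr.
Qed.

Lemma ler_tnth_lp_norm n (x : n.-tuple R) i : `|tnth x i| <= lp_norm p x.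
Proof.
case: p p0 => [r r0||//]/=; last by move=> _; exact: le_bigmax.
rewrite -[leLHS]powRr1// -[X in _ `^ X](@mulfV _ r) ?gt_eqF// powRrM.
apply: ge0_ler_powR; rewrite ?nnegrE ?invr_ge0 ?powR_ge0//.
- by rewrite -lee_fin ltW.
- by apply: sumr_ge0 => j _; exact: powR_ge0.
- rewrite (bigD1 i)//= lerDl.
  by apply: sumr_ge0 => j _; exact: powR_ge0.
Qed.

Lemma measurable_lp_norm n : measurable_fun setT (@lp_norm p n).
Proof.
have mx i : measurable_fun setT (fun x : n.-tuple R => `|tnth x i|).
  by apply: measurableT_comp => //; exact: measurable_tnth.
case: p p0 => [r r0||//]/=.
  apply: (measurableT_comp (measurable_powR _)) => //.
  apply: measurable_sum => i.
  exact: (measurableT_comp (measurable_powR _)).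
move=> _; suff mmax (s : seq 'I_n) : measurable_fun setT
    (fun x : n.-tuple R => \big[Num.max/0]_(i <- s) `|tnth x i|) by exact: mmax.
elim: s => [|i s IH]; first by
  rewrite (_ : (fun _ => _) = cst 0)//; apply/funext => x; rewrite big_nil.
rewrite (_ : (fun _ => _) = (fun x : n.-tuple R => `|tnth x i|) \max
    (fun x => \big[Num.max/0]_(j <- s) `|tnth x j|)).
  exact: (measurable_maxr (mx i) IH).
by apply/funext => x; rewrite big_cons.
Qed.

Lemma measurable_tuple_scale n (f : n.-tuple R -> R) :
  measurable_fun setT f ->
  measurable_fun setT (fun x : n.-tuple R => tuple_scale (f x) x).
Proof.
move=> mf; apply/measurable_fun_tnthP => i.
rewrite (_ : _ \o _ = fun x : n.-tuple R => f x * tnth x i); last first.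
  by apply/funext => x /=; rewrite tnth_mktuple.
by apply: measurable_funM => //; exact: measurable_tnth.
Qed.

(* The dilation of A by [0, 1] is, up to the origin, the part of
   [cone_body] that the radial projection sends to A. *)
Let cone_body n : set (n.-tuple R) :=
  [set x | forall i, 0 <= tnth x i] `&` @lp_norm p n @^-1` `]0, 1].

Let radial n (x : n.-tuple R) := tuple_scale (lp_norm p x)^-1 x.

Let measurable_radial n : measurable_fun setT (@radial n).
Proof.
apply: measurable_tuple_scale.
rewrite (_ : (fun _ => _) = (fun x : n.-tuple R => lp_norm p x `^ (-1))).
  exact: (measurableT_comp (measurable_powR _) (@measurable_lp_norm n)).
by apply/funext => x; rewrite powR_inv1// lp_norm_ge0.
Qed.

Let measurable_tnth_in n (B : 'I_n -> set R) :
  (forall i, measurable (B i)) ->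
  measurable [set x : n.-tuple R | forall i, B i (tnth x i)].
Proof.
move=> mB; rewrite (_ : mkset _ = \bigcap_(i in [set: 'I_n])
    ((fun x : n.-tuple R => tnth x i) @^-1` B i)).
  apply: fin_bigcap_measurable => // i _.
  by rewrite -[X in measurable X]setTI; exact: measurable_tnth.
by apply/seteqP; split => x /= h i; [move=> _|]; exact: h.
Qed.

Let measurable_cone_body n : measurable (@cone_body n).
Proof.
apply: measurableI.
  rewrite (_ : mkset _ = [set x | forall i, `[0, +oo[%classic (tnth x i)]).
    exact: (@measurable_tnth_in _ (fun=> `[0, +oo[%classic)).
  by apply/seteqP; split => x /= h i; have := h i; rewrite in_itv/= andbT.
by rewrite -[X in measurable X]setTI; exact: measurable_lp_norm.
Qed.

Let tuple0 n : n.-tuple R := [tuple 0 | _ < n].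

Let tuple_scaleA n s t (x : n.-tuple R) :
  tuple_scale s (tuple_scale t x) = tuple_scale (s * t) x.
Proof. by apply: eq_from_tnth => i; rewrite !tnth_mktuple mulrA. Qed.

Let tuple_scale1 n (x : n.-tuple R) : tuple_scale 1 x = x.
Proof. by apply: eq_from_tnth => i; rewrite !tnth_mktuple mul1r. Qed.

Let dilationE n (A : set (n.-tuple R)) : exists2 Z, Z `<=` [set tuple0 n] &
  dilation `[0, 1] (A `&` lp_sphere_pos p n) = Z `|` @cone_body n `&` @radial n @^-1` A.
Proof.
exists ([set tuple0 n] `&` [set _ | A `&` lp_sphere_pos p n !=set0]) => [x []//|].
rewrite (lp_sphere_posE n); apply/seteqP; split => [_ [t + [x [Ax [x0 Nx]] <-]]|x].
  rewrite /= in_itv/= => /andP[]; rewrite le_eqVlt => /predU1P[<- _|t0 t1].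
    left; split; last by exists x.
    by apply: eq_from_tnth => i; rewrite !tnth_mktuple mul0r.
  have Ntx : lp_norm p (tuple_scale t x) = t by rewrite lp_normZ ?ltW// Nx mulr1.
  right; split; first split.
  - by move=> i; rewrite tnth_mktuple mulr_ge0// ltW.
  - by rewrite /= Ntx in_itv/= t0.
  by rewrite /= /radial Ntx tuple_scaleA mulVf ?gt_eqF// tuple_scale1.
move=> [[-> [y yA]]|[[x0 /= +] Ax]].
  exists 0; first by rewrite /= in_itv/= lexx ler01.
  by exists y => //; apply: eq_from_tnth => i; rewrite !tnth_mktuple mul0r.
rewrite in_itv/= => /andP[Nx0 Nx1].
exists (lp_norm p x); first by rewrite /= in_itv/= Nx1 ltW.
exists (radial x); last by rewrite /radial tuple_scaleA mulfV ?gt_eqF// tuple_scale1.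
split => //; split.
  by move=> i; rewrite tnth_mktuple mulr_ge0// invr_ge0 ltW.
by rewrite lp_normZ ?invr_ge0 ?ltW// mulVf// gt_eqF.
Qed.

Let measurable_cone n (A : set (n.-tuple R)) : measurable A ->
  measurable (@cone_body n `&` @radial n @^-1` A).
Proof.
move=> mA; apply: measurableI => //.
by rewrite -[X in measurable X]setTI; exact: measurable_radial.
Qed.

Let lebesgue_tuple0 n : (0 < n)%N -> lebesgue_tuple [set tuple0 n] = 0%E.
Proof.
case: n => // n _.
rewrite (_ : [set _] = [set x | forall i, [set (0 : R)] (tnth x i)]).
  by rewrite (@lebesgue_tuple_box _ _ (fun=> [set 0]))// big_ord_recl/= lebesgue_measure_set1 mul0e.
apply/seteqP; split=> [x -> i /=|x x0]; first by rewrite tnth_mktuple.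
by apply: eq_from_tnth => i; rewrite tnth_mktuple; exact: x0.
Qed.

Let measurable_tuple1 n (y : n.-tuple R) : measurable [set y].
Proof.
rewrite (_ : [set y] = [set x | forall i, [set tnth y i] (tnth x i)]).
  exact: (@measurable_tnth_in _ (fun i => [set tnth y i])).
apply/seteqP; split => x /= => [->//|h].
by apply: eq_from_tnth => i; exact: h.
Qed.

Lemma measurable_dilation n (A : set (n.-tuple R)) : measurable A ->
  measurable (dilation `[0, 1] (A `&` lp_sphere_pos p n)).
Proof.
move=> mA; have [Z Z0 ->] := dilationE A.
apply: measurableU; last exact: measurable_cone.
by have [->|->] := subset_set1 Z0; [exact: measurable0|exact: measurable_tuple1].
Qed.

Let lebesgue_dilationE n (A : set (n.-tuple R)) : (0 < n)%N -> measurable A ->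
  lebesgue_tuple (dilation `[0, 1] (A `&` lp_sphere_pos p n)) =
  lebesgue_tuple (@cone_body n `&` @radial n @^-1` A).
Proof.
move=> n0 mA; have [Z Z0 ->] := dilationE A.
have mZ : measurable Z.
  by have [->|->] := subset_set1 Z0; [exact: measurable0|exact: measurable_tuple1].
rewrite setUC; apply: measureU0 => //; first exact: measurable_cone.
by have [->|->] := subset_set1 Z0; [exact: measure0|exact: lebesgue_tuple0].
Qed.

Lemma lebesgue_dilation_sphere_le1 n : (0 < n)%N ->
  (lebesgue_tuple (dilation `[0%R, 1%R] (lp_sphere_pos p n)) <= 1)%E.
Proof.
move=> n0; rewrite -[X in dilation _ X]setTI lebesgue_dilationE//.
rewrite (_ : 1%E = \prod_(i < n) lebesgue_measure `[0%R, 1%R]%classic)%E.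
  rewrite -(@lebesgue_tuple_box _ _ (fun=> `[0, 1]%classic))//; apply: le_measure; rewrite ?inE.
  - exact: measurable_cone.
  - exact: (@measurable_tnth_in _ (fun=> `[0, 1]%classic)).
  move=> x [[x0 /=]]; rewrite in_itv/= => /andP[_ Nx1] _ i.
  rewrite in_itv/= x0/= (le_trans (ler_norm _))//.
  exact: le_trans (ler_tnth_lp_norm _ _) Nx1.
by rewrite big1// => i _; rewrite lebesgue_measure_itv/= lte01 sube0.
Qed.

Lemma lebesgue_dilation_sphere_gt0 n : (0 < n)%N ->
  (0 < lebesgue_tuple (dilation `[0%R, 1%R] (lp_sphere_pos p n)))%E.
Proof.
move=> n0; rewrite -[X in dilation _ X]setTI lebesgue_dilationE//.
have [b b0 bN] : exists2 b : R, 0 < b & forall x : n.-tuple R,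
    (forall i, `]0, b]%classic (tnth x i)) -> lp_norm p x <= 1.
  case: p p0 => [r r0||//]/=; last first.
    move=> _; exists 1 => // x xb; apply/bigmax_leP; split => // i _.
    by have := xb i; rewrite /= in_itv/= => /andP[/ltW/ger0_norm->].
  have {}r0 : 0 < r by rewrite -lte_fin.
  exists (n%:R^-1 `^ r^-1); first by rewrite powR_gt0// invr_gt0 ltr0n.
  move=> x xb.
  have S0 : 0 <= \sum_(i < n) `|tnth x i| `^ r.
    by apply: sumr_ge0 => i _; exact: powR_ge0.
  suff S1 : \sum_(i < n) `|tnth x i| `^ r <= 1.
    rewrite [leRHS](_ : _ = 1 `^ r^-1); last by rewrite powR1.
    by apply: ge0_ler_powR => //; rewrite ?invr_ge0 ?ltW// nnegrE.
  rewrite [leRHS](_ : _ = \sum_(i < n) n%:R^-1); last first.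
    by rewrite sumr_const card_ord -[RHS]mulr_natr mulVf// pnatr_eq0 -lt0n.
  apply: ler_sum => i _; have := xb i; rewrite /= in_itv/= => /andP[xi0 xib].
  rewrite (ger0_norm (ltW xi0)).
  rewrite [leRHS](_ : _ = (n%:R^-1 `^ r^-1) `^ r).
    by apply: ge0_ler_powR => //; rewrite ?nnegrE ?powR_ge0 ?ltW.
  by rewrite -powRrM mulVf ?gt_eqF// powRr1// invr_ge0.
apply: (@lt_le_trans _ _ (lebesgue_tuple
    [set x : n.-tuple R | forall i, `]0, b]%classic (tnth x i)])).
  rewrite (@lebesgue_tuple_box _ _ (fun=> `]0, b]%classic))//.
  rewrite (eq_bigr (fun=> b%:E)) => [|i _].
    by rewrite prodEFin lte_fin prodr_gt0.
  by rewrite lebesgue_measure_itv/= lte_fin b0 sube0.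
apply: le_measure; rewrite ?inE.
- exact: (@measurable_tnth_in _ (fun=> `]0, b]%classic)).
- exact: measurable_cone.
move=> x xb; split => //; split=> /= [i|].
  by have := xb i; rewrite /= in_itv/= => /andP[/ltW].
rewrite in_itv/= bN// andbT.
have := xb (Ordinal n0); rewrite /= in_itv/= => /andP[xi0 _].
by apply: lt_le_trans (ler_tnth_lp_norm x (Ordinal n0)); rewrite gtr0_norm.
Qed.

Let cone_measure_is_measure n : exists mu : {measure set (n.-tuple R) -> \bar R},
  forall A, measurable A -> cone_measure p0 A = mu A.
Proof.
have [->|n0] := posnP n.
  exists mzero => A mA; rewrite /cone_measure.
  have dil0 (B : set (0.-tuple R)) :
      dilation `[0, 1] (B `&` lp_sphere_pos p 0) = set0.
    rewrite -subset0 lp_sphere_posE => z [t _ [x [_ [_ Nx]] _]]; move: Nx.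
    case: p p0 => [r r0||//]/=; rewrite big_ord0.
      rewrite powR0; first by move/esym/eqP; rewrite oner_eq0.
      by rewrite invr_eq0 gt_eqF.
    by move=> _ /esym/eqP; rewrite oner_eq0.
  by rewrite dil0 measure0 mul0e.
set c := lebesgue_tuple (dilation `[0, 1] (lp_sphere_pos p n)).
have c_gt0 : (0 < c)%E by exact: lebesgue_dilation_sphere_gt0.
have c_fin : c \is a fin_num.
  rewrite ge0_fin_numE ?ltW//.
  by rewrite (le_lt_trans (lebesgue_dilation_sphere_le1 n0))// ltry.
have fc_gt0 : 0 < fine c by rewrite fine_gt0// c_gt0 ltey_eq c_fin.
have k_ge0 : 0 <= (fine c)^-1 by rewrite invr_ge0 ltW.
exists (mscale (NngNum k_ge0)
  (measure_function_pushforward__canonical__measure_function_Measure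
    (mrestr (@lebesgue_tuple R n) (@measurable_cone_body n))
    (@measurable_radial n))) => A mA.
rewrite /cone_measure lebesgue_dilationE// -/c -[in LHS](fineK c_fin).
by rewrite inver gt_eqF// muleC setIC.
Qed.

Let cone_measure0 n : cone_measure p0 (set0 : set (n.-tuple R)) = 0%E.
Proof. by have [mu muE] := cone_measure_is_measure n; rewrite muE ?measure0. Qed.

Let cone_measure_ge0 n (A : set (n.-tuple R)) : (0 <= cone_measure p0 A)%E.
Proof. by rewrite mule_ge0// inve_ge0. Qed.

Let cone_measure_sigma_additive n :
  semi_sigma_additive (@cone_measure p p0 n).
Proof.
have [mu muE] := cone_measure_is_measure n => F mF tF mUF.
rewrite muE// (_ : (fun _ => _) = fun k => (\sum_(0 <= i < k) mu (F i))%E).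
  exact: measure_semi_sigma_additive.
by apply/funext => k; apply: eq_bigr => i _; rewrite muE.
Qed.

HB.instance Definition _ n := isMeasure.Build _ _ _ (@cone_measure p p0 n)
  (cone_measure0 n) (@cone_measure_ge0 n) (@cone_measure_sigma_additive n).

Lemma cone_measureT n : (0 < n)%N ->
  cone_measure p0 [set: n.-tuple R] = 1%E.
Proof.
move=> n0; rewrite /cone_measure setTI.
have c_gt0 := lebesgue_dilation_sphere_gt0 n0.
rewrite divee ?gt_eqF// ge0_fin_numE ?ltW//.
by rewrite (le_lt_trans (lebesgue_dilation_sphere_le1 n0))// ltry.
Qed.

End cone.
End lp.

Arguments lp_norm {R} q {n} x.
Arguments lp_sphere_pos {R} p n _.
Arguments cone_measure {R p} p0 n A : rename.
Arguments best_approx {R} q {n} m x.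
Arguments avg_width {R} p q {n} m mu.

(* Main.v *)
(* Let x have independent coordinates of density proportional to exp (- t ^ r) on
   [0, +oo[. Writing exp (- |x|_r ^ r) as the integral of exp (- u) over
   u >= |x|_r ^ r (layer cake) shows that x / |x|_r follows the normalized cone
   measure, so the average width is the mean of sigma_m (x) / |x|_r, where
   sigma_m (x) is the (m+1)-st largest coordinate; for p = +oo the same holds
   with uniform coordinates. All the means needed factor over the coordinates.
   Upper bound: (m+1) exp (sigma_m ^ r / 2) <= sum_i exp (x_i ^ r / 2) bounds the
   mean of sigma_m by C ln (e n / (m+1)) ^ (1/r), and |x|_r ^ r < c n has
   exponentially small probability (Chernoff). Lower bound: two more Chernoff
   bounds show that with probability at least 1/2 more than m coordinates exceed
   s ~ ln (e n / (m+1)) ^ (1/r) and |x|_r ^ r <= K n. *)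
Require Import Defs.
From mathcomp Require Import all_boot all_order all_algebra.
From mathcomp Require Import all_classical all_reals all_analysis.
From mathcomp Require Import measurable_realfun zify ring lra.
Set Implicit Arguments.
Unset Strict Implicit.
Unset Printing Implicit Defensive.
Import Order.TTheory GRing.Theory Num.Theory.
Import numFieldNormedType.Exports.
Local Open Scope classical_set_scope.
Local Open Scope ring_scope.

(** * Integration on tuples *)

(** The obstacle is the factor 1 / |x|_r, which couples the coordinates. No conditioning is used:
    the quotient is compared pointwise with finite sums of constants times products of one-variable
    functions, and rescaling makes each one-dimensional integral an explicit multiple of z, the
    integral of exp (- t ^ r) over t >= 0. The value of z never matters; identities stay multiplied
    by z ^ n or by a volume, so nothing is divided in the extended reals. The exponent 1/2 in exp
    (x_i ^ r / 2) keeps the product with exp (- x_i ^ r) integrable. In the lower bound, with L = ln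
    (e n / (m+1)), the threshold s is set by (2 s) ^ r = L / 2: the mass above s is then at least s
    exp (- L / 2), which is s times the square root of (m+1) / (e n). The expected number of
    coordinates above s is thus at least of order the square root of n (m+1), which beats m as soon
    as n / (m+1) exceeds a constant; this is the origin of eps. When that ratio is small, m <= eps n
    leaves only m = 0 and bounded n. *)

Section tuple_integral.
Context {R : realType}.
Local Notation leb := (@lebesgue_measure R).
Local Notation lam n := (@lebesgue_tuple R n).

Lemma integral_tupleS n (f : n.+1.-tuple R -> \bar R) :
  measurable_fun setT f -> (forall x, (0 <= f x)%E) ->
  (\int[lam n.+1]_x f x =
   \int[leb]_x \int[lam n]_y f (tuple_of_pair (x, y)))%E.
Proof.
move=> mf f0.
have mt := @measurable_tuple_of_pair R n.
rewrite [LHS](_ : _ = \int[leb \x lam n]_z (f \o @tuple_of_pair R n) z)%E.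
  rewrite fubini_tonelli1//; first exact: measurableT_comp.
  by move=> x /=.
rewrite (eq_measure_integral
  (measure_function_pushforward__canonical__measure_function_Measure
    (leb \x lam n)%E mt))//.
by rewrite ge0_integral_pushforward.
Qed.

Lemma integral_tuple0 (f : 0.-tuple R -> \bar R) :
  (\int[lam 0]_x f x = f [tuple])%E.
Proof.
rewrite [LHS](_ : _ = \int[\d_([tuple] : 0.-tuple R)]_x f x)%E//.
rewrite integral_dirac//; first by rewrite diracT mul1e.
move=> _ A _; rewrite setTI.
have [H|H] := pselect (A (f [tuple])).
  rewrite (_ : _ @^-1` _ = setT)//; apply/seteqP; split => // x _ /=.
  by rewrite (tuple0 x).
rewrite (_ : _ @^-1` _ = set0)//; apply/seteqP; split => // x /=.
by rewrite (tuple0 x).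
Qed.

Lemma measurable_tuple_section n (f : n.+1.-tuple R -> \bar R) x :
  measurable_fun setT f -> measurable_fun setT (fun y => f (tuple_of_pair (x, y))).
Proof.
move=> mf; apply: (measurableT_comp mf).
apply: (measurableT_comp (@measurable_tuple_of_pair R n)).
exact: measurable_pair1.
Qed.

Lemma measurable_integral_section n (f : n.+1.-tuple R -> \bar R) :
  measurable_fun setT f -> (forall x, (0 <= f x)%E) ->
  measurable_fun [set: R] (fun x => \int[lam n]_y f (tuple_of_pair (x, y)))%E.
Proof.
move=> mf f0.
apply: (@measurable_fun_fubini_tonelli_F _ _ _ _ R (lam n)
  (f \o @tuple_of_pair R n)) => //.
  exact: (measurableT_comp mf (@measurable_tuple_of_pair R n)).
by move=> x /=.
Qed.

(** Independence of the coordinates: Tonelli splits off one coordinate at a time, and nonnegativity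
    is enough even if some factors are infinite. *)
Lemma integral_tuple_prod n (h : 'I_n -> R -> R) :
  (forall i, measurable_fun setT (h i)) -> (forall i x, 0 <= h i x) ->
  (\int[lam n]_x (\prod_(i < n) h i (tnth x i))%:E =
   \prod_(i < n) \int[leb]_x (h i x)%:E)%E.
Proof.
elim: n h => [|n IH] h mh h0.
  by rewrite integral_tuple0 !big_ord0.
rewrite integral_tupleS; last 2 first.
- apply/measurable_EFinP; apply: measurable_prod => i _.
  by apply: measurableT_comp => //; exact: measurable_tnth.
- by move=> x; rewrite lee_fin prodr_ge0.
rewrite big_ord_recl -IH//.
have mprod : measurable_fun setT (fun y : n.-tuple R =>
    (\prod_(i < n) h (lift ord0 i) (tnth y i))%:E).
  apply/measurable_EFinP; apply: measurable_prod => i _.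
  by apply: measurableT_comp => //; exact: measurable_tnth.
rewrite -ge0_integralZr//; last 3 first.
- by apply/measurable_EFinP; exact: mh.
- by move=> x _; rewrite lee_fin.
- by apply: integral_ge0 => y _; rewrite lee_fin prodr_ge0.
apply: eq_integral => x _; rewrite -ge0_integralZl ?lee_fin//; last first.
  by move=> y _; rewrite lee_fin prodr_ge0.
apply: eq_integral => y _; rewrite big_ord_recl -EFinM; congr (_ * _)%:E.
by apply: eq_bigr => i _; rewrite tnthS; congr (h _ (tnth _ _)); exact: val_inj.
Qed.

(** The pushforward gives A the measure of A / t, whence the factor t. The scaled measure agrees
    with length on half-open intervals, and Lebesgue measure is the only one that does. *)
Lemma lebesgue_measure_scale (t : R) (A : set R) : 0 < t -> measurable A ->
  (t%:E * pushforward leb ( *%R t : _ -> measurableTypeR R) A = leb A)%E.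
Proof.
move=> t0 mA.
have mt : measurable_fun [set: R] ( *%R t : R -> measurableTypeR R).
  exact: measurable_funM.
pose nu := mscale (NngNum (ltW t0))
  (measure_function_pushforward__canonical__measure_function_Measure leb mt).
rewrite [LHS](_ : _ = nu A)//; apply/esym/lebesgue_measure_unique => //.
move=> _ [[a b]] _ <-.
rewrite /nu /= /mscale /= /pushforward (_ : _ @^-1` _ = `]t^-1 * a, t^-1 * b]%classic).
  rewrite !lebesgue_measure_itv/= !lte_fin ltr_pM2l ?invr_gt0//.
  case: ifPn => _; last by rewrite mule0.
  by rewrite -!EFinB -EFinM -mulrBr mulrA mulfV ?gt_eqF// mul1r.
apply/seteqP; split => x; rewrite /= !in_itv/= ltr_pdivrMl// ler_pdivlMl//.
Qed.

Lemma integral_scale (t : R) (f : R -> \bar R) : 0 < t ->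
  measurable_fun setT f -> (forall x, (0 <= f x)%E) ->
  (\int[leb]_x f x = t%:E * \int[leb]_x f (t * x)%R)%E.
Proof.
move=> t0 mf f0.
have mt : measurable_fun [set: R] ( *%R t : R -> measurableTypeR R).
  exact: measurable_funM.
pose nu := measure_function_pushforward__canonical__measure_function_Measure leb mt.
rewrite (eq_measure_integral (mscale (NngNum (ltW t0)) nu)); last first.
  by move=> A mA _; exact/esym/lebesgue_measure_scale.
rewrite ge0_integral_mscale//=; congr (_ * _)%E.
by rewrite ge0_integral_pushforward.
Qed.

Lemma integral_tuple_scale n (t : R) (f : n.-tuple R -> \bar R) : 0 < t ->
  measurable_fun setT f -> (forall x, (0 <= f x)%E) ->
  (\int[lam n]_x f x =
   (t ^+ n)%:E * \int[lam n]_x f (tuple_scale t x))%E.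
Proof.
move=> t0; elim: n f => [|n IH] f mf f0.
  rewrite !integral_tuple0 expr0 mul1e.
  by rewrite [in RHS]tuple0.
have ms : measurable_fun setT (fun x : n.+1.-tuple R => f (tuple_scale t x)).
  exact: (measurableT_comp mf (@measurable_tuple_scale _ _ (fun=> t) _)).
rewrite integral_tupleS// (integral_scale t0)//; last 2 first.
- exact: measurable_integral_section.
- by move=> x; apply: integral_ge0.
rewrite integral_tupleS// exprS EFinM -muleA; congr (_ * _)%E.
rewrite -ge0_integralZl//; last 3 first.
- exact: (measurable_integral_section ms).
- by move=> x _; apply: integral_ge0.
- by rewrite lee_fin exprn_ge0// ltW.
apply: eq_integral => x _; rewrite IH//; last exact: measurable_tuple_section.
congr (_ * _)%E; apply: eq_integral => y _; congr f.
by apply: eq_from_tnth => i; rewrite tnth_mktuple; have [j ->|->] := unliftP ord0 i;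
  rewrite ?tnthS ?tnth_mktuple// tnthS tnth_mktuple.
Qed.

End tuple_integral.

(** * The layer cake formula *)

Section layer_cake.
Context {R : realType}.
Local Notation leb := (@lebesgue_measure R).
Local Notation lam n := (@lebesgue_tuple R n).

Lemma integral_expRN (s : R) :
  (\int[leb]_(u in `[s, +oo[) (expR (- u))%:E = (expR (- s))%:E)%E.
Proof.
have cN : continuous (fun u : R => expR (- u)).
  by move=> u; apply: continuous_comp; [exact: opp_continuous|exact: continuous_expR].
rewrite (@ge0_continuous_FTC2y _ (fun u => expR (- u)) (fun u => - expR (- u)) s 0)//.
- by rewrite EFinN oppeK add0e.
- by apply: continuous_subspaceT; exact: cN.
- by rewrite -[X in _ --> X]oppr0; apply: cvgN; exact: cvgr_expR.
- by apply: cvg_at_right_filter; apply: cvgN; exact: cN.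
- move=> u _; rewrite derive1N// derive1_comp// derive1N// derive1_id mulrN1.
  by rewrite derive1E; have /funeqP -> := @derive_expR R; rewrite opprK.
Qed.

(** Indicators replace the domain of integration so that the integrand can be put on the product
    space. The restriction to u > 0 is there because the layer cake later rescales by u ^ (1/r),
    which must be positive. *)
Lemma integral_expRN_pos (s : R) : 0 <= s ->
  (\int[leb]_u (\1_(`]0, +oo[) u * \1_(`[s, +oo[) u * expR (- u))%:E =
   (expR (- s))%:E)%E.
Proof.
move=> s0; have me (D : set R) : measurable_fun D (fun u : R => (expR (- u))%:E).
  apply/measurable_EFinP; apply: measurable_funS (measurableT) _ _ => //.
  by apply: (measurableT_comp (@measurable_expR R)); exact: oppr_measurable.
transitivity (\int[leb]_(u in `]s, +oo[) (expR (- u))%:E)%E; last first.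
  by rewrite integral_itv_obnd_cbnd// integral_expRN.
(* The product of the two indicators is that of the open half-line if s = 0 and of the closed one if
   s > 0; they differ by a null endpoint. *)
have [->|s_gt0] := eqVneq s 0.
  rewrite [RHS]integral_mkcond; apply: eq_integral => u _.
  rewrite patchE !indicE; case: ifPn => [|] uI.
    rewrite mem_set ?mul1r//=; last first.
      by move: uI; rewrite inE/= !in_itv/= !andbT => /ltW.
  by rewrite !mul0r.
rewrite integral_itv_obnd_cbnd// [RHS]integral_mkcond; apply: eq_integral => u _.
rewrite patchE !indicE; case: ifPn => [|] uI.
  rewrite mem_set ?mul1r//=.
  move: uI; rewrite inE/= !in_itv/= !andbT; apply: lt_le_trans.
  by rewrite lt_neqAle eq_sym s_gt0.
by rewrite mulr0 mul0r.
Qed.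

Lemma measurable_sum_powR (r : R) n :
  measurable_fun setT (fun x : n.-tuple R => \sum_(i < n) `|tnth x i| `^ r).
Proof.
apply: measurable_sum => i; apply: (measurableT_comp (measurable_powR _)) => //.
by apply: measurableT_comp => //; exact: measurable_tnth.
Qed.

Lemma sum_powR_scale (r t : R) n (x : n.-tuple R) : 0 <= t ->
  \sum_(i < n) `|tnth (tuple_scale t x) i| `^ r =
  t `^ r * \sum_(i < n) `|tnth x i| `^ r.
Proof.
move=> t0; rewrite mulr_sumr; apply: eq_bigr => i _.
by rewrite tnth_mktuple normrM powRM// ger0_norm.
Qed.

(** After Tonelli the inner integral runs over N (x) <= u, which is the unit ball dilated by u ^
    (1/r); as [h] is constant on rays, the dilation only contributes u ^ (n/r). The point is that
    the first factor does not depend on [h], so two instances can be compared without computing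
    it. *)
Lemma layer_cake (r : R) n (h : n.-tuple R -> \bar R) : 0 < r ->
  measurable_fun setT h -> (forall x, (0 <= h x)%E) ->
  (forall t x, 0 < t -> h (tuple_scale t x) = h x) ->
  (\int[lam n]_x (h x * (expR (- \sum_(i < n) `|tnth x i| `^ r))%:E) =
   (\int[leb]_u (\1_(`]0%R, +oo[) u * (u `^ r^-1) ^+ n * expR (- u))%:E) *
   \int[lam n]_(x in [set x | (\sum_(i < n) `|tnth x i| `^ r <= 1)%R]) h x)%E.
Proof.
move=> r0 mh h0 hh.
pose N (x : n.-tuple R) := \sum_(i < n) `|tnth x i| `^ r.
have mN : measurable_fun setT N by exact: measurable_sum_powR.
have N0 x : 0 <= N x by apply: sumr_ge0 => i _; exact: powR_ge0.
rewrite -/(N _).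
pose B := [set z : n.-tuple R * R | N z.1 <= z.2].
have mB : measurable B.
  rewrite (_ : B = (fun z : n.-tuple R * R => z.2 - N z.1) @^-1` `[0, +oo[).
    rewrite -[X in measurable X]setTI; apply: measurable_funB => //.
    exact: measurableT_comp.
  by apply/seteqP; split => z; rewrite /B/= in_itv/= andbT subr_ge0.
pose k (z : n.-tuple R * R) : \bar R :=
  (h z.1 * (\1_(`]0, +oo[%classic : set R) z.2 * \1_B z * expR (- z.2))%:E)%E.
have k0 z : (0 <= k z)%E by rewrite /k mule_ge0// lee_fin !mulr_ge0// expR_ge0.
have mk : measurable_fun setT k.
  apply: emeasurable_funM; first exact: measurableT_comp.
  apply/measurable_EFinP; apply: measurable_funM.
    apply: measurable_funM; last exact: measurable_indic.
    by apply: measurableT_comp => //; exact: measurable_indic.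
  apply: (measurableT_comp (@measurable_expR R)).
  by apply: (measurableT_comp (@oppr_measurable R _)).
transitivity (\int[lam n]_x \int[leb]_u k (x, u))%E.
  apply: eq_integral => x _; rewrite /k/= ge0_integralZl//.
  - rewrite -(integral_expRN_pos (N0 x)); congr (_ * _)%E.
    apply: eq_integral => u _; congr (_ * _ * _)%:E; rewrite !indicE.
    by congr ((_ : bool)%:R); apply/idP/idP; rewrite !inE /B/= in_itv/= andbT.
  - apply/measurable_EFinP; apply: measurable_funM.
      apply: measurable_funM; first exact: measurable_indic.
      by apply: (measurableT_comp (@measurable_indic _ _ R _ _ mB)).
    apply: (measurableT_comp (@measurable_expR R)); exact: oppr_measurable.
rewrite (@fubini_tonelli _ _ _ _ _ (lam n) leb _ mk k0).
rewrite -ge0_integralZr//; last 3 first.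
- apply/measurable_EFinP; apply: measurable_funM.
    apply: measurable_funM; first exact: measurable_indic.
    by apply: measurable_funX; exact: measurable_powR.
  by apply: (measurableT_comp (@measurable_expR R)); exact: oppr_measurable.
- by move=> u _; rewrite lee_fin !mulr_ge0// ?expR_ge0// exprn_ge0// powR_ge0.
- exact: integral_ge0.
apply: eq_integral => u _; rewrite /k/=.
have [u0|u0] := leP u 0.
  rewrite !indicE memNset ?mul0r ?mul0e; last first.
    by rewrite /= in_itv/= andbT; apply/negP; rewrite -leNgt.
  by rewrite integral0_eq// => x _; rewrite !mul0r mule0.
have t0 : 0 < u `^ r^-1 by rewrite powR_gt0.
(* Substituting u ^ (1/r) x for x turns N (x) <= u into N (x) <= 1. *)
rewrite (integral_tuple_scale t0)//; last 2 first.
- exact: (measurable_fun_pair1 u mk).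
- by move=> x; exact: (k0 (x, u)).
rewrite [\1_(_) u]indicE mem_set ?mul1r; last by rewrite /= in_itv/= u0.
rewrite EFinM -muleA; congr (_ * _)%E.
have mB1 : measurable [set x : n.-tuple R | N x <= 1].
  rewrite (_ : mkset _ = N @^-1` `]-oo, 1]); last first.
    by apply/seteqP; split => x; rewrite /= in_itv.
  by rewrite -[X in measurable X]setTI; exact: mN.
rewrite [in RHS]integral_mkcond -ge0_integralZl ?lee_fin ?expR_ge0//; last 2 first.
- by apply/(measurable_restrictT h mB1); exact: measurable_funTS.
- by move=> x _; exact: erestrict_ge0.
apply: eq_integral => x _; rewrite hh// patchE !indicE muleC.
have -> : ((tuple_scale (u `^ r^-1) x, u) \in B) =
    (x \in [set x : n.-tuple R | N x <= 1]).
  apply/idP/idP; rewrite !inE /B/= /N sum_powR_scale ?(ltW t0)//;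
  by rewrite -powRrM mulVf ?gt_eqF// powRr1 ?(ltW u0)// -ler_pdivlMl// mulVf ?gt_eqF.
by case: ifPn => _; rewrite !mul1r// mul0r mul0e mule0.
Qed.

End layer_cake.

(** * Integration against the cone measure *)

Section cone_integral.
Context {R : realType}.
Local Notation lam n := (@lebesgue_tuple R n).

Lemma tuple_scaleA n s t (x : n.-tuple R) :
  tuple_scale s (tuple_scale t x) = tuple_scale (s * t) x.
Proof. by apply: eq_from_tnth => i; rewrite !tnth_mktuple mulrA. Qed.

Lemma tuple_scale1 n (x : n.-tuple R) : tuple_scale 1 x = x.
Proof. by apply: eq_from_tnth => i; rewrite !tnth_mktuple mul1r. Qed.

Definition orthant n : set (n.-tuple R) := [set x | forall i, 0 <= tnth x i].

Lemma measurable_orthant n : measurable (@orthant n).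
Proof.
rewrite (_ : @orthant n = \bigcap_(i in [set: 'I_n])
    ((fun x : n.-tuple R => tnth x i) @^-1` `[0, +oo[)).
  apply: fin_bigcap_measurable => // i _.
  by rewrite -[X in measurable X]setTI; exact: measurable_tnth.
by apply/seteqP; split => x /= h i; [move=> _; rewrite /= in_itv/= h
  |have /= := h i I; rewrite in_itv/= andbT].
Qed.

(** Serves to ignore the origin, which lies in every nonempty cone but has no direction. In
    dimension 0 points have mass 1, hence 0 < n. *)
Lemma lebesgue_tuple_eq_but_point n (z : n.-tuple R) (A B : set (n.-tuple R)) :
  (0 < n)%N -> measurable A -> measurable B ->
  A `<=` B `|` [set z] -> B `<=` A `|` [set z] -> lam n A = lam n B.
Proof.
case: n z A B => // n z A B _ mA mB AB BA.
have zE : [set z] = [set x | forall i, [set tnth z i] (tnth x i)].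
  apply/seteqP; split=> [x -> //|x xz].
  by apply: eq_from_tnth => i; exact: xz.
have mz : measurable [set z].
  rewrite zE (_ : mkset _ = \bigcap_(i in [set: 'I_n.+1])
      ((fun x : n.+1.-tuple R => tnth x i) @^-1` [set tnth z i])).
    apply: fin_bigcap_measurable => // i _.
    by rewrite -[X in measurable X]setTI; exact: measurable_tnth.
  by apply/seteqP; split => x /= h i; [move=> _|]; exact: h.
have z0 : lam n.+1 [set z] = 0%E.
  rewrite zE (@lebesgue_tuple_box _ _ (fun i => [set tnth z i]))// big_ord_recl.
  by rewrite lebesgue_measure_set1 mul0e.
apply/eqP; rewrite eq_le; apply/andP; split.
  rewrite -(measureU0 mB mz z0); apply: le_measure; rewrite ?inE//.
  exact: measurableU.
rewrite -(measureU0 mA mz z0); apply: le_measure; rewrite ?inE//.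
exact: measurableU.
Qed.

Variable p : \bar R.
Hypothesis p0 : (0 < p)%E.

Lemma lp_norm_eq0 n (x : n.-tuple R) : lp_norm p x = 0 -> x = [tuple 0 | _ < n].
Proof.
move=> x0; apply: eq_from_tnth => i; rewrite tnth_mktuple.
by apply/normr0_eq0/eqP; rewrite eq_le normr_ge0 -[X in _ <= X]x0 ler_tnth_lp_norm.
Qed.

Lemma measurable_lp_sphere_pos n : measurable (lp_sphere_pos p n : set (n.-tuple R)).
Proof.
rewrite lp_sphere_posE// (_ : mkset _ = @orthant n `&` @lp_norm _ p n @^-1` [set 1])//.
apply: measurableI; first exact: measurable_orthant.
by rewrite -[X in measurable X]setTI; exact: measurable_lp_norm.
Qed.

(** Total because the inverse of 0 is 0: the origin goes to itself, which is off the sphere. *)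
Definition radial n (x : n.-tuple R) := tuple_scale (lp_norm p x)^-1 x.

Lemma measurable_inv_lp_norm n :
  measurable_fun setT (fun x : n.-tuple R => (lp_norm p x)^-1).
Proof.
rewrite (_ : (fun _ => _) = (fun x : n.-tuple R => lp_norm p x `^ (-1))).
  apply: (measurableT_comp (measurable_powR _)); exact: measurable_lp_norm.
by apply/funext => x; rewrite powR_inv1// lp_norm_ge0.
Qed.

Lemma measurable_radial n : measurable_fun setT (@radial n).
Proof. by apply: measurable_tuple_scale; exact: measurable_inv_lp_norm. Qed.

Lemma radialZ n t (x : n.-tuple R) : 0 < t -> radial (tuple_scale t x) = radial x.
Proof.
move=> t0; rewrite /radial tuple_scaleA lp_normZ ?ltW// invfM mulrC mulrA.
by rewrite mulfV ?gt_eqF// mul1r.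
Qed.

Lemma radial_sphere n (x : n.-tuple R) :
  lp_sphere_pos p n (radial x) <-> orthant x /\ lp_norm p x != 0.
Proof.
rewrite lp_sphere_posE//; split=> [[x0]|[x0 Nx]].
  rewrite /radial lp_normZ ?invr_ge0 ?lp_norm_ge0// => /eqP.
  have [->|Nx _] := eqVneq (lp_norm p x) 0.
    by rewrite mulr0 eq_sym oner_eq0.
  split=> // i; have := x0 i; rewrite tnth_mktuple pmulr_rge0// invr_gt0.
  by rewrite lt_neqAle eq_sym Nx lp_norm_ge0.
split=> [i|].
  by rewrite tnth_mktuple mulr_ge0// invr_ge0 lp_norm_ge0.
by rewrite /radial lp_normZ ?invr_ge0 ?lp_norm_ge0// mulVf.
Qed.

Definition lp_ball n : set (n.-tuple R) := [set x | lp_norm p x <= 1].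

Lemma measurable_lp_ball n : measurable (@lp_ball n).
Proof.
rewrite (_ : @lp_ball n = @lp_norm _ p n @^-1` `]-oo, 1]); last first.
  by apply/seteqP; split => x; rewrite /lp_ball/= in_itv.
by rewrite -[X in measurable X]setTI; exact: measurable_lp_norm.
Qed.

(** Polar coordinates: apart from the origin, x lies in the cone over a part of the sphere iff its
    norm is at most 1 and its direction is in that part. The sphere carries the sign condition, so
    the full ball can be used. *)
Lemma lebesgue_dilation n (A : set (n.-tuple R)) : (0 < n)%N -> measurable A ->
  lam n (dilation `[0, 1] (A `&` lp_sphere_pos p n)) =
  lam n (@lp_ball n `&` @radial n @^-1` (A `&` lp_sphere_pos p n)).
Proof.
move=> n0 mA; apply: (@lebesgue_tuple_eq_but_point _ [tuple 0 | _ < n]) => //.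
- exact: measurable_dilation.
- apply: measurableI; first exact: measurable_lp_ball.
  rewrite -[X in measurable X]setTI.
  by apply: measurable_radial => //; apply: measurableI => //; exact: measurable_lp_sphere_pos.
- move=> _ [t + [x [Ax Sx] <-]]; rewrite /= in_itv/= => /andP[].
  rewrite le_eqVlt => /predU1P[<- _|t0 t1].
    by right; apply: eq_from_tnth => i; rewrite !tnth_mktuple mul0r.
  move: (Sx); rewrite lp_sphere_posE// => -[x0 Nx].
  left; split; first by rewrite /lp_ball/= lp_normZ ?Nx ?mulr1 // (ltW t0).
  rewrite /= radialZ// (_ : radial x = x); first by split.
  by rewrite /radial Nx invr1 tuple_scale1.
- move=> x [Bx [Ax Sx]]; left; have [x0 Nx] := (radial_sphere x).1 Sx.
  exists (lp_norm p x); first by rewrite /= in_itv/= lp_norm_ge0.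
  by exists (radial x) => //; rewrite /radial tuple_scaleA mulfV// tuple_scale1.
Qed.

Lemma lebesgue_dilation_sphere n : (0 < n)%N ->
  lam n (dilation `[0, 1] (lp_sphere_pos p n)) = lam n (@lp_ball n `&` @orthant n).
Proof.
move=> n0; rewrite -[X in dilation _ X]setTI lebesgue_dilation// setTI.
apply: (@lebesgue_tuple_eq_but_point _ [tuple 0 | _ < n]) => //.
- apply: measurableI; first exact: measurable_lp_ball.
  rewrite -[X in measurable X]setTI.
  by apply: measurable_radial => //; exact: measurable_lp_sphere_pos.
- by apply: measurableI; [exact: measurable_lp_ball|exact: measurable_orthant].
- by move=> x [Bx /radial_sphere[]]; left.
- move=> x [Bx x0]; have [/lp_norm_eq0->|Nx] := eqVneq (lp_norm p x) 0; first by right.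
  by left; split => //; apply/radial_sphere.
Qed.

(** Up to normalization the cone measure is the image of Lebesgue measure on the ball under
    [radial], so this is a change of variables, with the normalizing volume moved to the left. *)
Lemma integral_cone_measure n (f : n.-tuple R -> \bar R) : (0 < n)%N ->
  measurable_fun setT f -> (forall x, (0 <= f x)%E) ->
  (lam n (@lp_ball n `&` @orthant n) *
    \int[cone_measure p0 n]_(x in lp_sphere_pos p n) f x =
   \int[lam n]_(x in @lp_ball n) (f \_ (lp_sphere_pos p n)) (radial x))%E.
Proof.
move=> n0 mf f0; rewrite -lebesgue_dilation_sphere//.
set c := lam n _.
have c_gt0 : (0 < c)%E by exact: lebesgue_dilation_sphere_gt0.
have c_fin : c \is a fin_num.
  rewrite ge0_fin_numE ?ltW//.
  by rewrite (le_lt_trans (lebesgue_dilation_sphere_le1 p0 n0))// ltry.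
have fc_gt0 : 0 < fine c by rewrite fine_gt0// c_gt0 ltey_eq c_fin.
have k_ge0 : 0 <= (fine c)^-1 by rewrite invr_ge0 ltW.
(* The part outside the ball is sent to the origin, which is not on the sphere. *)
pose phi (x : n.-tuple R) := tuple_scale (\1_(@lp_ball n) x * (lp_norm p x)^-1) x.
have mphi : measurable_fun setT phi.
  apply: measurable_tuple_scale; apply: measurable_funM.
    exact: (@measurable_indic _ _ R _ _ (@measurable_lp_ball n)).
  exact: measurable_inv_lp_norm.
have mS := @measurable_lp_sphere_pos n.
have phiE x : @lp_ball n x -> phi x = radial x.
  by move=> Bx; rewrite /phi indicE mem_set// mul1r.
have phiN x : ~ @lp_ball n x -> ~ lp_sphere_pos p n (phi x).
  move=> Bx; rewrite lp_sphere_posE//= /phi indicE memNset// mul0r lp_normZ//.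
  by rewrite mul0r => -[_ /eqP]; rewrite eq_sym oner_eq0.
pose nu := measure_function_pushforward__canonical__measure_function_Measure
  (lam n) mphi.
rewrite (eq_measure_integral (mscale (NngNum k_ge0) nu)); last first.
  move=> A mA AS; rewrite [LHS]/(cone_measure _ _ _) /cone_measure -/c.
  rewrite -[in LHS](fineK c_fin) inver gt_eqF// muleC /mscale/=; congr (_ * _)%E.
  rewrite lebesgue_dilation// (setIidl AS) /nu /= /pushforward; congr (lam n).
  apply/seteqP; split=> x /=; first by move=> [Bx]; rewrite phiE.
  have [Bx|Bx] := pselect (@lp_ball n x); first by rewrite phiE.
  by move=> /AS /(phiN _ Bx).
rewrite ge0_integral_mscale//=; last exact: measurable_funTS.
rewrite muleA -[X in (X * _ * _)%E](fineK c_fin) -EFinM mulfV ?gt_eqF// mul1e.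
rewrite ge0_integral_pushforward//=; last exact: measurable_funTS.
rewrite integral_mkcond [RHS]integral_mkcond; apply: eq_integral => x _.
rewrite !patchE; have [Bx|Bx] := pselect (@lp_ball n x).
  rewrite [x \in @lp_ball n]mem_set//= phiE//.
  congr (if _ then _ else _).
  by apply/idP/idP; rewrite !inE/= phiE.
rewrite [x \in @lp_ball n]memNset//= memNset//; exact: phiN.
Qed.

End cone_integral.

(** * The cone measure as the radial image of a product measure *)

Section product_representation.
Context {R : realType}.
Local Notation leb := (@lebesgue_measure R).
Local Notation lam n := (@lebesgue_tuple R n).

(* The cone measure is the image under the radial projection of the normalized
   product of the measures of density w; z is the integral of w. *)
Definition cone_density (p : \bar R) (p0 : (0 < p)%E) (w : R -> R) (z : R) :=
  [/\ measurable_fun setT w, (forall u, 0 <= w u) /\ (forall u, u < 0 -> w u = 0),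
   (\int[leb]_u (w u)%:E = z%:E)%E &
  forall n (f : n.-tuple R -> \bar R), (0 < n)%N ->
  measurable_fun setT f -> (forall x, (0 <= f x)%E) ->
  ((z ^+ n)%:E * \int[cone_measure p0 n]_(x in lp_sphere_pos p n) f x =
   \int[lam n]_x ((f \_ (lp_sphere_pos p n)) (radial p x) *
     (\prod_(i < n) w (tnth x i))%:E))%E].

Definition exp_density (r u : R) := \1_(`[0, +oo[%classic : set R) u * expR (- `|u| `^ r).

Lemma exp_density_ge0 r u : 0 <= exp_density r u.
Proof. by rewrite mulr_ge0// expR_ge0. Qed.

Lemma measurable_exp_density r : measurable_fun setT (exp_density r).
Proof.
apply: measurable_funM; first exact: measurable_indic.
apply: (measurableT_comp (@measurable_expR R)).
apply: (measurableT_comp (@oppr_measurable R _)).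
apply: (measurableT_comp (measurable_powR _)).
exact: normr_measurable.
Qed.

Lemma prod_indic (A : set R) n (x : n.-tuple R) :
  \prod_(i < n) \1_A (tnth x i) = \1_[set x : n.-tuple R | forall i, A (tnth x i)] x :> R.
Proof.
rewrite !indicE; have [h|/existsNP[i h]] := pselect (forall i, A (tnth x i)).
  by rewrite mem_set// big1// => i _; rewrite indicE mem_set.
by rewrite memNset; [rewrite (bigD1 i)//= indicE memNset// mul0r|move=> /(_ i)].
Qed.

Lemma prod_exp_density r n (x : n.-tuple R) :
  \prod_(i < n) exp_density r (tnth x i) =
  \1_(@orthant R n) x * expR (- \sum_(i < n) `|tnth x i| `^ r).
Proof.
rewrite big_split/= prod_indic -sumrN expR_sum; congr (_ * _).
rewrite !indicE; congr ((_ : bool)%:R); apply/idP/idP; rewrite !inE /orthant/=;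
  by move=> h i; have := h i; rewrite in_itv/= andbT.
Qed.

Lemma lp_norm_le1 (r : R) n (x : n.-tuple R) : 0 < r ->
  (lp_norm r%:E x <= 1) = (\sum_(i < n) `|tnth x i| `^ r <= 1).
Proof.
move=> r0 /=; have S0 : 0 <= \sum_(i < n) `|tnth x i| `^ r.
  by apply: sumr_ge0 => i _; exact: powR_ge0.
apply/idP/idP => [h|h].
  rewrite -[leLHS]powRr1// -[X in _ `^ X](@mulVf _ r) ?gt_eqF// powRrM.
  rewrite [leRHS](_ : _ = 1 `^ r); last by rewrite powR1.
  by apply: ge0_ler_powR; rewrite ?nnegrE ?powR_ge0// ltW.
rewrite [leRHS](_ : _ = 1 `^ r^-1); last by rewrite powR1.
by apply: ge0_ler_powR; rewrite ?nnegrE ?invr_ge0// ltW.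
Qed.

Lemma measurable_radial_patch p (p0 : (0 < p)%E) n (f : n.-tuple R -> \bar R) :
  measurable_fun setT f ->
  measurable_fun setT (fun x => (f \_ (lp_sphere_pos p n)) (radial p x)).
Proof.
move=> mf; have mfS : measurable_fun setT (f \_ (lp_sphere_pos p n)).
  apply/(measurable_restrictT f); first exact: measurable_lp_sphere_pos.
  exact: measurable_funTS.
have H := measurableT_comp mfS (measurable_radial p0 (n:=n)).
exact: H.
Qed.

(** The layer cake is applied twice, to the integrand and to the indicator of the orthant. The
    second instance says that z ^ n is the common radial factor times the volume of the positive
    part of the ball, and that volume is the normalization of the cone measure. *)
Lemma cone_density_exp (r z : R) (p0 : (0 < r%:E)%E) :
  (\int[leb]_u (exp_density r u)%:E = z%:E)%E ->
  cone_density p0 (exp_density r) z.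
Proof.
move=> zE; split => //.
- exact: measurable_exp_density.
- split; first exact: exp_density_ge0.
  move=> u u0; rewrite /exp_density indicE memNset ?mul0r//.
  by rewrite /= in_itv/= andbT; apply/negP; rewrite -ltNge.
move=> n f n0 mf f0.
have r0 : 0 < r by rewrite -lte_fin.
have BE : @lp_ball R r%:E n =
    [set x | (\sum_(i < n) `|tnth x i| `^ r <= 1)%R].
  by apply/seteqP; split => x /=; rewrite /lp_ball/= -lp_norm_le1.
set h := fun x => (f \_ (lp_sphere_pos r%:E n)) (radial r%:E x).
have mh : measurable_fun setT h by exact: measurable_radial_patch.
have h0 x : (0 <= h x)%E by exact: erestrict_ge0.
have hh t x : 0 < t -> h (tuple_scale t x) = h x by move=> t0; rewrite /h radialZ.
have mO := @measurable_orthant R n.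
pose o (x : n.-tuple R) : \bar R := (\1_(@orthant R n) x)%:E.
have mo : measurable_fun setT o.
  by apply/measurable_EFinP; exact: (@measurable_indic _ _ R _ _ mO).
have o0 x : (0 <= o x)%E by rewrite lee_fin.
have oh t x : 0 < t -> o (tuple_scale t x) = o x.
  move=> t0; rewrite /o !indicE; congr ((_ : bool)%:R)%:E.
  by apply/idP/idP; rewrite !inE /orthant/= => xx i; have := xx i;
    rewrite tnth_mktuple pmulr_rge0.
have LC := layer_cake r0 mo o0 oh; have LCh := layer_cake r0 mh h0 hh.
have zn : (\int[lam n]_x (o x * (expR (- \sum_(i < n) `|tnth x i| `^ r))%:E) =
    (z ^+ n)%:E)%E.
  under eq_integral do rewrite /o -EFinM -prod_exp_density.
  rewrite (@integral_tuple_prod _ _ (fun=> exp_density r)); last 2 first.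
  - by move=> i; exact: measurable_exp_density.
  - by move=> _ u; exact: exp_density_ge0.
  by under eq_bigr do rewrite zE; rewrite prodEFin prodr_const card_ord.
rewrite -{}zn {}LC -BE integral_indic//; last exact: measurable_lp_ball.
rewrite setIC -muleA integral_cone_measure// BE -LCh; apply: eq_integral => x _.
rewrite prod_exp_density indicE; have [xO|xO] := boolP (x \in _).
  by rewrite mul1r.
(* Off the orthant the density is 0; the left side vanishes too, since [radial] does not land on the
   positive sphere. *)
rewrite mul0r mule0 /h patchE memNset ?mul0e// => /(radial_sphere p0)[+ _].
by move=> Ox; rewrite mem_set in xO.
Qed.

(** The positive part of the sup-norm ball is the unit cube, of volume 1, so the polar formula
    already has product form and no layer cake is needed. *)
Lemma cone_density_unif (p0 : (0 < +oo :> \bar R)%E) :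
  cone_density p0 (\1_(`[0, 1]%classic : set R)) 1.
Proof.
split.
- exact: measurable_indic.
- split=> // u u0; rewrite indicE memNset//= in_itv/=; apply/negP.
  by rewrite negb_and -ltNge u0.
- rewrite integral_indic//= setIT. by rewrite lebesgue_measure_itv/= lte01 sube0.
move=> n f n0 mf f0; rewrite expr1n mul1e.
have BO : @lp_ball R +oo%E n `&` @orthant R n = [set x | forall i, `[0, 1]%classic (tnth x i)].
  apply/seteqP; split=> x /=.
    move=> [Bx x0] i; rewrite in_itv/= x0/=.
    by rewrite (le_trans (ler_norm _))// (le_trans (ler_tnth_lp_norm p0 x i)).
  move=> h; split=> [|i]; last by have := h i; rewrite in_itv/= => /andP[].
  rewrite /lp_ball/=; apply/bigmax_leP; split => // i _.
  by have := h i; rewrite in_itv/= => /andP[? ?]; rewrite ger0_norm.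
have V1 : lam n (@lp_ball R +oo%E n `&` @orthant R n) = 1%E.
  rewrite BO (@lebesgue_tuple_box _ _ (fun=> `[0, 1]%classic))//.
  by rewrite big1// => i _; rewrite lebesgue_measure_itv/= lte01 sube0.
rewrite -[LHS]mul1e -[X in (X * _)%E]V1 integral_cone_measure//.
rewrite integral_mkcond; apply: eq_integral => x _.
rewrite prod_indic -BO indicE patchE in_setI.
case: (x \in @lp_ball R _ n) => /=; last by rewrite mule0.
have [xO|xO] := boolP (x \in _); first by rewrite mule1.
rewrite mule0 patchE memNset// => /(radial_sphere p0)[+ _].
by move=> Ox; rewrite mem_set in xO.
Qed.

End product_representation.

(** * Best m-term approximation in the sup norm *)

Section best_approx_sup.
Context {R : realType}.
Implicit Types (n m : nat).

Lemma best_approx_ge0 q n m (x : n.-tuple R) : 0 <= best_approx q m x.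
Proof.
apply: lb_le_inf; last by move=> _ [y _ <-]; exact: lp_norm_ge0.
exists (lp_norm q [tuple tnth x i - tnth [tuple 0 | _ < n] i | i < n]).
exists [tuple 0 | _ < n] => //=; rewrite eq_card0// => i.
by rewrite !inE tnth_mktuple eqxx.
Qed.

Lemma best_approx_le_norm q n m (x y : n.-tuple R) :
  (#|[pred i | tnth y i != 0%R]| <= m)%N ->
  best_approx q m x <= lp_norm q [tuple tnth x i - tnth y i | i < n].
Proof.
move=> ym; apply: ge_inf; last by exists y.
by exists 0 => _ [z _ <-]; exact: lp_norm_ge0.
Qed.

(* For the sup norm the error is the (m+1)-st largest |x_i|. *)
Lemma best_approx_sup_le n m (x : n.-tuple R) s : 0 <= s ->
  (best_approx +oo m x <= s) = (#|[pred i | (s < `|tnth x i|)%R]| <= m)%N.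
Proof.
move=> s0; apply/idP/idP => [|cm]; last first.
  (* Keeping exactly the entries larger than s leaves an error of at most s. *)
  pose y := [tuple if s < `|tnth x i| then tnth x i else 0 | i < n].
  apply: le_trans (@best_approx_le_norm +oo _ m x y _) _.
    apply: leq_trans cm; apply: subset_leq_card; apply/fintype.subsetP => i.
    by rewrite !inE tnth_mktuple; case: ifP => //; rewrite eqxx.
  apply/bigmax_leP; split => // i _; rewrite !tnth_mktuple.
  by case: ltP => [_|]; rewrite ?subrr ?normr0 ?subr0.
apply: contraTT; rewrite -ltnNge -ltNge => cm.
have [i0 i0s] : exists i0, s < `|tnth x i0|.
  have /card_gt0P[i] : (0 < #|[pred i | (s < `|tnth x i|)%R]|)%N by exact: leq_ltn_trans cm.
  by rewrite inE => ?; exists i.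
(* The smallest entry above s gives a uniform gap: any admissible y vanishes at some entry above s,
   so every error, hence the infimum, is at least |x_k| > s. *)
have [k ks kmin] := @arg_minP _ _ _ i0 (fun i => s < `|tnth x i|)
  (fun i => `|tnth x i|) i0s.
apply: (lt_le_trans ks); apply: lb_le_inf.
  exists (lp_norm +oo [tuple tnth x i - tnth [tuple 0 | _ < n] i | i < n]).
  exists [tuple 0 | _ < n] => //=; rewrite eq_card0// => i.
  by rewrite !inE tnth_mktuple eqxx.
move=> _ [y /= ym <-].
have [i] : exists i, (s < `|tnth x i|) && (tnth y i == 0).
  apply/existsP; apply: contraTT cm; rewrite negb_exists => /forallP h.
  rewrite -leqNgt (leq_trans _ ym)//; apply: subset_leq_card; apply/fintype.subsetP => i.
  by rewrite !inE => si; have := h i; rewrite si.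
move=> /andP[si /eqP yi]; apply: le_trans (kmin i si) _.
apply: le_trans (@le_bigmax _ _ _ _ _ i).
by rewrite tnth_mktuple yi subr0.
Qed.

(** The counting criterion is about entries strictly above a level; this is the version with a weak
    inequality at the error itself, which is attained. *)
Lemma best_approx_sup_card n m (x : n.-tuple R) : (m < n)%N ->
  (m < #|[pred i | (best_approx +oo m x <= `|tnth x i|)%R]|)%N.
Proof.
move=> mn; set t := best_approx +oo m x.
have [t0|t0] := eqVneq t 0.
  rewrite eq_cardT ?size_enum_ord// => i; by rewrite inE t0 normr_ge0.
have {}t0 : 0 < t by rewrite lt_neqAle eq_sym t0 best_approx_ge0.
rewrite ltnNge; apply/negP => cm.
(* The largest entry below t: no entry lies strictly between s and t, so if at most m entries
   reached t, the error would be at most s < t. *)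
pose s := \big[Num.max/0]_(i < n | `|tnth x i| < t) `|tnth x i|.
have st : s < t by apply/bigmax_ltP.
have : t <= s.
  rewrite best_approx_sup_le; last exact: bigmax_ge_id.
  apply: leq_trans cm; apply: subset_leq_card; apply/fintype.subsetP => i.
  rewrite !inE; apply: contraTT; rewrite -ltNge -leNgt => it.
  exact: (le_bigmax_cond 0 (P := fun i => `|tnth x i| < t) (fun i => `|tnth x i|) it).
by rewrite leNgt st.
Qed.

(** By the counting criterion both sides have the same nonnegative upper bounds. *)
Lemma best_approx_supZ n m (x : n.-tuple R) t : 0 < t ->
  best_approx +oo m (tuple_scale t x) = t * best_approx +oo m x.
Proof.
move=> t0; have key s : 0 <= s ->
    (best_approx +oo m (tuple_scale t x) <= s) = (t * best_approx +oo m x <= s).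
  move=> s0; rewrite -ler_pdivlMl// mulrC !best_approx_sup_le ?divr_ge0// ?ltW//.
  congr (_ <= _)%N; apply: eq_card => i.
  by rewrite !inE tnth_mktuple normrM (gtr0_norm t0) ltr_pdivrMr// mulrC.
apply/eqP; rewrite eq_le key ?lexx ?mulr_ge0 ?best_approx_ge0 ?(ltW t0)//=.
by rewrite -key ?best_approx_ge0.
Qed.

Lemma best_approx_sup_le_lp p n m (x : n.-tuple R) : (0 < p)%E ->
  best_approx +oo m x <= lp_norm p x.
Proof.
move=> p0; rewrite best_approx_sup_le ?lp_norm_ge0// eq_card0// => i.
by rewrite !inE ltNge ler_tnth_lp_norm.
Qed.

Lemma le_best_approx_sup0 n (x : n.-tuple R) i :
  `|tnth x i| <= best_approx +oo 0 x.
Proof.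
have := lexx (best_approx +oo 0 x); rewrite best_approx_sup_le ?best_approx_ge0//.
by rewrite leqn0 => /eqP/card0_eq/(_ i); rewrite !inE => /negbT; rewrite -leNgt.
Qed.

(** The error exceeds s >= 0 iff more than m entries do, and the number of such entries is a sum of
    measurable indicators. *)
Lemma measurable_best_approx_sup n m :
  measurable_fun setT (fun x : n.-tuple R => best_approx +oo m x).
Proof.
apply: (measurability _ (RGenOInfty.measurableE R)) => //.
move=> _ [_ [s ->] <-]; rewrite setTI.
have [s0|s0] := ltP s 0.
  rewrite (_ : _ @^-1` _ = setT)//; apply/seteqP; split => // x _ /=.
  by rewrite in_itv/= andbT (lt_le_trans s0)// best_approx_ge0.
pose N (x : n.-tuple R) : R := \sum_(i < n) \1_(`]s, +oo[%classic : set R) `|tnth x i|.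
rewrite (_ : _ @^-1` _ = N @^-1` `]m%:R, +oo[).
  rewrite -[X in measurable X]setTI.
  have mN : measurable_fun setT N.
    apply: measurable_sum => i.
    apply: (measurableT_comp (@measurable_indic _ _ R _ _ _)); first exact: measurable_itv.
    by apply: (measurableT_comp (@normr_measurable R _)); exact: measurable_tnth.
  exact: mN.
apply/seteqP; suff H x : (best_approx +oo m x \in `]s, +oo[) = (N x \in `]m%:R, +oo[).
  by split=> x /=; rewrite H.
rewrite !in_itv/= !andbT ltNge best_approx_sup_le// ltNge; congr (~~ _).
rewrite -(ler_nat R) -sum1_card natr_sum /N.
rewrite [in RHS](eq_bigr (fun i => (s < `|tnth x i|)%R%:R)).
  by rewrite big_mkcond/=; congr (_ <= _); apply: eq_bigr => i _; rewrite inE; case: ifP.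
move=> i _; rewrite indicE; congr ((_ : bool)%:R).
by apply/idP/idP; rewrite !inE/= in_itv/= andbT.
Qed.

End best_approx_sup.

(** * The one-dimensional exponential density and elementary power inequalities *)

Section exp_density_integral.
Context {R : realType}.
Local Notation leb := (@lebesgue_measure R).

(** The inequality u / b <= exp (u / b), raised to the power b. *)
Lemma powR_le_expR (b u : R) : 0 < b -> 0 <= u -> u `^ b <= b `^ b * expR u.
Proof.
move=> b0 u0; rewrite [in leLHS](_ : u = b * (u / b)); last first.
  by rewrite mulrC divfK// gt_eqF.
rewrite powRM ?divr_ge0 ?(ltW b0)//; apply: ler_wpM2l; first exact: powR_ge0.
rewrite [leRHS](_ : _ = expR (u / b) `^ b); last first.
  by rewrite -expRM divfK// gt_eqF.
apply: ge0_ler_powR; rewrite ?nnegrE ?expR_ge0 ?divr_ge0 ?(ltW b0)//.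
by rewrite (le_trans _ (expR_ge1Dx _))// lerDr.
Qed.

Lemma ler_powR2r (b x y : R) : 0 <= b -> 0 <= x -> x <= y -> x `^ b <= y `^ b.
Proof.
move=> b0 x0 xy; apply: ge0_ler_powR => //; rewrite nnegrE//.
exact: le_trans xy.
Qed.

Lemma integral_exp_density (r : R) : 0 < r ->
  exists2 z, 0 < z & (\int[leb]_u (exp_density r u)%:E = z%:E)%E.
Proof.
move=> r0; set I := (\int[leb]_u _)%E.
have mw : measurable_fun setT (EFin \o exp_density r).
  by apply/measurable_EFinP; exact: measurable_exp_density.
have Ipos : (0 < I)%E.
  apply: (@lt_le_trans _ _ (\int[leb]_(u in `[0%R, 1%R]) (expR (- 1))%:E)%E).
    rewrite integral_cst//= lebesgue_measure_itv/= lte01 sube0 mule1.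
    by rewrite lte_fin expR_gt0.
  apply: (@le_trans _ _ (\int[leb]_(u in `[0%R, 1%R]) (exp_density r u)%:E)%E).
    apply: ge0_le_integral => //; first exact: measurable_funTS.
    move=> u; rewrite /= in_itv/= => /andP[u0 u1]; rewrite lee_fin /exp_density indicE.
    rewrite mem_set ?mul1r; last by rewrite /= in_itv/= u0.
    rewrite ler_expR lerN2 ger0_norm// -[leRHS](powRr0 1) powRr0.
    by rewrite -[leRHS](congr1 (fun f => f r) (@powR1 R)); apply: ler_powR2r => //; exact: ltW.
  by apply: ge0_subset_integral => // u _; rewrite lee_fin exp_density_ge0.
(* Finiteness by comparison with C / (1 + u ^ 2), whose integral is C pi / 2: u ^ 2 is the power 2 /
   r of u ^ r, so [powR_le_expR] bounds it by (2 / r) ^ (2 / r) exp (u ^ r), and 1 <= exp (u ^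
   r). *)
pose C := 1 + (2 / r) `^ (2 / r).
have C0 : 0 <= C by rewrite addr_ge0 ?powR_ge0.
have Ifin : (I < +oo)%E.
  apply: (@le_lt_trans _ _ (C * (pi / 2))%:E); last exact: ltry.
  have mO : measurable_fun (`[0, +oo[%classic : set R) (fun u : R => ((oneDsqr u)^-1)%:E).
    apply/measurable_EFinP; apply: measurable_funTS.
    by apply: continuous_measurable_fun; exact: continuous_oneDsqrV.
  have O0 u : 0 < oneDsqr u :> R by rewrite (lt_le_trans _ (oneDsqr_ge1 u)).
  rewrite EFinM -integral0y_oneDsqr -ge0_integralZl//.
  rewrite [leRHS]integral_mkcond; apply: ge0_le_integral => //.
  - by move=> u _; rewrite lee_fin exp_density_ge0.
  - have mCO := measurable_funeM C%:E mO.
    by have := (measurable_restrictT _ (measurable_itv _)).1 mCO; exact.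
  move=> u _; rewrite patchE /exp_density indicE; case: ifPn => uI; last by rewrite mul0r.
  rewrite -EFinM lee_fin mul1r ler_pdivlMr//.
  rewrite mulrC -ler_pdivlMr ?expR_gt0// expRN invrK /oneDsqr mulrDl mul1r.
  apply: lerD; first by rewrite -[leLHS]expR0 ler_expR powR_ge0.
  have -> : u ^+ 2 = (`|u| `^ r) `^ (2 / r).
    rewrite -powRrM mulrC divfK ?gt_eqF// -[2]/(2%:R) powR_mulrn// real_normK//.
    exact: num_real.
  by apply: powR_le_expR; rewrite ?powR_ge0// divr_gt0.
have zE : I = (fine I)%:E by rewrite fineK// ge0_fin_numE// ltW.
by exists (fine I) => //; rewrite -lte_fin -zE.
Qed.

(** Substitution of a ^ (-1/r) u for u. It is used at a = 2 and a = 1/2, for the exponential moments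
    of both signs. *)
Lemma integral_exp_density_scale (r a z : R) : 0 < r -> 0 < a ->
  (\int[leb]_u (exp_density r u)%:E = z%:E)%E ->
  (\int[leb]_u (\1_(`[0%R, +oo[%classic : set R) u * expR (- (a * `|u| `^ r)))%:E =
    (a `^ (- r^-1) * z)%:E)%E.
Proof.
move=> r0 a0 zE; have t0 : 0 < a `^ (- r^-1) by rewrite powR_gt0.
rewrite (integral_scale t0); last 2 first.
- apply/measurable_EFinP; apply: measurable_funM; first exact: measurable_indic.
  apply: (measurableT_comp (@measurable_expR R)).
  apply: (measurableT_comp (@oppr_measurable R _)); apply: measurable_funM => //.
  by apply: (measurableT_comp (measurable_powR _)); exact: normr_measurable.
- by move=> u; rewrite lee_fin mulr_ge0// expR_ge0.
rewrite EFinM -zE; congr (_ * _)%E; apply: eq_integral => u _.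
congr (_ * expR (- _))%:E.
  rewrite !indicE; congr ((_ : bool)%:R); apply/idP/idP;
  by rewrite !inE/= !in_itv/= !andbT pmulr_rge0.
rewrite normrM powRM// (gtr0_norm t0) -powRrM mulNr mulVf ?gt_eqF// powR_inv1 ?(ltW a0)//.
by rewrite mulrA mulfV ?gt_eqF// mul1r.
Qed.

(* Used with [L = ln (e n / (m + 1))], for which [e ^ (1 - L) = (m + 1) / n]. *)
Lemma le_powR_expR_shift (r L s : R) : 0 < r -> 0 <= s -> 1 <= L ->
  s <= (2 * L) `^ r^-1 * (1 + r^-1 `^ r^-1 * expR (s `^ r / 2 - L + 1)).
Proof.
move=> r0 s0 L1; set z := s `^ r / 2.
have z0 : 0 <= z by rewrite divr_ge0// powR_ge0.
have L0 : 0 < L by rewrite (lt_le_trans _ L1).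
have -> : s = (2 * L) `^ r^-1 * (z / L) `^ r^-1.
  rewrite -powRM ?mulr_ge0 ?invr_ge0 ?powR_ge0 ?(ltW L0)//.
  rewrite (_ : 2 * L * (z / L) = s `^ r); last by rewrite /z; field; rewrite gt_eqF.
  by rewrite -powRrM mulfV ?gt_eqF// powRr1.
apply: ler_wpM2l; first exact: powR_ge0.
have b0 : 0 <= r^-1 by rewrite invr_ge0 ltW.
have [zL|Lz] := leP z L.
  apply: (@le_trans _ _ 1); last by rewrite lerDl mulr_ge0 ?powR_ge0 ?expR_ge0.
  rewrite [leRHS](_ : _ = 1 `^ r^-1); last by rewrite powR1.
  by apply: ler_powR2r => //; [exact: divr_ge0 z0 (ltW L0)|rewrite ler_pdivrMr// mul1r].
apply: (@le_trans _ _ (r^-1 `^ r^-1 * expR (z - L + 1))); last by rewrite lerDr.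
(* After multiplication by L this is (z - L) (L - 1) >= 0. *)
have zLle : z / L <= z - L + 1.
  by rewrite ler_pdivrMr//; nra.
apply: (@le_trans _ _ ((z - L + 1) `^ r^-1)).
  by apply: ler_powR2r => //; rewrite divr_ge0// ltW.
by apply: powR_le_expR; [rewrite invr_gt0|lra].
Qed.

End exp_density_integral.

(** * Upper bound *)

Section upper_bound.
Context {R : realType}.
Local Notation leb := (@lebesgue_measure R).
Local Notation lam n := (@lebesgue_tuple R n).

Lemma measurable_prod_tuple n (k : R) (g : 'I_n -> R -> R) :
  (forall i, measurable_fun setT (g i)) ->
  measurable_fun setT (fun x : n.-tuple R => (k * \prod_(i < n) g i (tnth x i))%:E).
Proof.
move=> mg; apply/measurable_EFinP; apply: measurable_funM => //.
apply: measurable_prod => i _.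
by apply: measurableT_comp => //; exact: measurable_tnth.
Qed.

Lemma integral_prod_fin n (k : R) (g : 'I_n -> R -> R) (c : 'I_n -> R) : 0 <= k ->
  (forall i, measurable_fun setT (g i)) -> (forall i u, 0 <= g i u) ->
  (forall i, (\int[leb]_u (g i u)%:E = (c i)%:E)%E) ->
  (\int[lam n]_x (k * \prod_(i < n) g i (tnth x i))%:E = (k * \prod_i c i)%:E)%E.
Proof.
move=> k0 mg g0 gc; under eq_integral do rewrite EFinM.
rewrite ge0_integralZl//; last 2 first.
- have := measurable_prod_tuple 1 mg.
  by under eq_fun do rewrite mul1r.
- by move=> x _; rewrite lee_fin prodr_ge0.
rewrite integral_tuple_prod// EFinM -prodEFin; congr (_ * _)%E.
by apply: eq_bigr => i _.
Qed.

(** The error is homogeneous, so projecting divides it by the norm. At the origin both sides are 0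
    because the inverse of 0 is 0. *)
Lemma patch_best_approx_radial p n m (x : n.-tuple R) : (0 < p)%E ->
  (((EFin \o best_approx +oo m) \_ (lp_sphere_pos p n)) (radial p x) =
   (\1_(@orthant R n) x * (best_approx +oo m x / lp_norm p x))%:E)%E.
Proof.
move=> p0; rewrite patchE indicE.
have [Nx|Nx] := eqVneq (lp_norm p x) 0.
  rewrite Nx invr0 !mulr0 memNset// => /(radial_sphere p0)[_].
  by rewrite Nx eqxx.
have [xO|xO] := pselect (orthant x).
  rewrite !mem_set//; last by apply/(radial_sphere p0).
  rewrite mul1r /= /radial best_approx_supZ 1?mulrC//.
  by rewrite invr_gt0 lt_neqAle eq_sym Nx lp_norm_ge0.
by rewrite !memNset ?mul0r// => /(radial_sphere p0)[].
Qed.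

(** More than m entries reach the error, and each contributes at least the exponential on the
    left. *)
Lemma sum_expR_ge n m (r : R) (x : n.-tuple R) : 0 < r -> (m < n)%N ->
  m.+1%:R * expR (best_approx +oo m x `^ r / 2) <=
  \sum_(i < n) expR (`|tnth x i| `^ r / 2).
Proof.
move=> r0 mn; set t := best_approx +oo m x.
have t0 : 0 <= t by exact: best_approx_ge0.
apply: (@le_trans _ _ (\sum_(i < n | t <= `|tnth x i|) expR (t `^ r / 2))).
  rewrite sumr_const -[leRHS]mulr_natl ler_wpM2r ?expR_ge0// ler_nat.
  exact: best_approx_sup_card.
rewrite big_mkcond/=; apply: ler_sum => i _; case: ifPn => [ti|_]; last exact: expR_ge0.
by rewrite ler_expR ler_wpM2r ?invr_ge0// ler_powR2r// ltW.
Qed.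

Lemma ln_ratio_ge1 (n m : nat) : (m < n)%N ->
  1 <= ln (expR 1 * n%:R / m.+1%:R) :> R.
Proof.
move=> mn; rewrite -[leLHS]expRK.
rewrite ler_ln ?posrE ?expR_gt0 ?divr_gt0 ?mulr_gt0 ?expR_gt0 ?ltr0n//; last first.
  exact: leq_ltn_trans mn.
by rewrite ler_pdivlMr ?ltr0n// ler_wpM2l ?expR_ge0// ler_nat.
Qed.

(** A pointwise bound whose terms become products over the coordinates once multiplied by the
    density. If N < c n, the quotient is at most 1, hence at most the last exponential (Chernoff in
    pointwise form). Otherwise the norm is at least (c n) ^ (1/r) and only the error has to be
    bounded. *)
Lemma best_approx_ratio_le n m (r c : R) (x : n.-tuple R) : 0 < r -> 0 < c ->
  (m < n)%N ->
  best_approx +oo m x / lp_norm r%:E x <=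
  (2 * ln (expR 1 * n%:R / m.+1%:R) / (c * n%:R)) `^ r^-1 *
    (1 + r^-1 `^ r^-1 / n%:R * \sum_(i < n) expR (`|tnth x i| `^ r / 2)) +
  expR (c * n%:R - \sum_(i < n) `|tnth x i| `^ r).
Proof.
move=> r0 c0 mn; set L := ln _; set N := \sum_(i < n) `|tnth x i| `^ r.
set t := best_approx +oo m x.
have nn : (0 < n)%N by exact: leq_ltn_trans mn.
have n0 : 0 < n%:R :> R by rewrite ltr0n.
have L1 : 1 <= L by exact: ln_ratio_ge1.
have t0 : 0 <= t by exact: best_approx_ge0.
have b0 : 0 <= r^-1 by rewrite invr_ge0 ltW.
have xE : lp_norm r%:E x = N `^ r^-1 by [].
have N0 : 0 <= N by apply: sumr_ge0 => i _; exact: powR_ge0.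
have S0 : 0 <= 1 + r^-1 `^ r^-1 / n%:R * \sum_(i < n) expR (`|tnth x i| `^ r / 2).
  rewrite addr_ge0// mulr_ge0// ?divr_ge0 ?powR_ge0//.
  by apply: sumr_ge0 => i _; exact: expR_ge0.
have [Ncn|cnN] := ltP N (c * n%:R).
  apply: (@le_trans _ _ 1); last first.
    rewrite -[leLHS]add0r lerD ?mulr_ge0 ?powR_ge0//.
    by rewrite -[leLHS]expR0 ler_expR subr_ge0 ltW.
  have [->|x0] := eqVneq (lp_norm r%:E x) 0; first by rewrite invr0 mulr0.
  rewrite ler_pdivrMr ?mul1r; last by rewrite lt_neqAle eq_sym x0 lp_norm_ge0.
  by apply: best_approx_sup_le_lp; rewrite lte_fin.
rewrite -[leLHS]addr0 lerD ?expR_ge0// xE.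
have cn0 : 0 < c * n%:R by rewrite mulr_gt0.
apply: (@le_trans _ _ (t / (c * n%:R) `^ r^-1)).
  rewrite ler_wpM2l// lef_pV2 ?posrE ?powR_gt0// ?(lt_le_trans cn0)//.
  by apply: ler_powR2r => //; exact: ltW.
have L2 : 0 <= 2 * L by rewrite mulr_ge0// (le_trans _ L1).
rewrite ler_pdivrMr ?powR_gt0// mulrAC -powRM ?divr_ge0 ?(ltW cn0)//.
rewrite divfK ?gt_eqF//.
apply: le_trans (le_powR_expR_shift r0 t0 L1) _.
rewrite ler_wpM2l ?powR_ge0// lerD2l -mulrA ler_wpM2l ?powR_ge0//.
(* The shift is exp (1 - L) = (m+1) / n, whose numerator is the factor in [sum_expR_ge]. *)
rewrite ler_pdivlMl// -addrA expRD (_ : expR (- L + 1) = m.+1%:R / n%:R).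
  rewrite mulrCA mulrC [X in X * _](_ : _ = m.+1%:R); last by field; rewrite gt_eqF.
  exact: sum_expR_ge.
rewrite expRD expRN /L lnK ?posrE ?divr_gt0 ?mulr_gt0 ?expR_gt0 ?ltr0n//.
by field; rewrite !gt_eqF ?expR_gt0//.
Qed.

Lemma avg_width_le_exp (r z : R) (p0 : (0 < r%:E)%E) (c : R) n m : 0 < r -> 0 < c ->
  0 < z -> (\int[leb]_u (exp_density r u)%:E = z%:E)%E -> (m < n)%N ->
  (avg_width r%:E +oo m (cone_measure p0 n) <=
   ((2 * ln (expR 1 * n%:R / m.+1%:R) / (c * n%:R)) `^ r^-1 * (1 + r^-1 `^ r^-1 * 2 `^ r^-1) +
    (expR c * 2 `^ (- r^-1)) ^+ n)%:E)%E.
Proof.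
move=> r0 c0 z0 zE mn; set L := ln _; set K := (_ + _)%R.
have n0 : (0 < n)%N by rewrite (leq_ltn_trans _ mn).
have [mw [w0 _] _ /(_ n (EFin \o best_approx +oo m) n0) rep] := cone_density_exp p0 zE.
have zn0 : 0 < z ^+ n by rewrite exprn_gt0.
rewrite -(@lee_pmul2l _ (z ^+ n)%:E)// rep; last 2 first.
- by apply/measurable_EFinP; exact: measurable_best_approx_sup.
- by move=> x; rewrite lee_fin best_approx_ge0.
set w := exp_density r.
pose a := (2 * L / (c * n%:R)) `^ r^-1.
(* The i-th summand of the exponential sum times the density is a product in which only the i-th
   factor is changed. *)
pose k i (j : 'I_n) u := (if j == i then expR (`|u| `^ r / 2) else 1) * w u.
pose v u := expR (- `|u| `^ r) * w u.
have mnp : measurable_fun [set: R] (fun u : R => `|u| `^ r).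
  by apply: (measurableT_comp (measurable_powR _)); exact: normr_measurable.
have mk i j : measurable_fun setT (k i j).
  apply: measurable_funM => //; case: (j == i) => //.
  apply: (measurableT_comp (@measurable_expR R)); exact: measurable_funM.
have mv : measurable_fun setT v.
  apply: measurable_funM => //; apply: (measurableT_comp (@measurable_expR R)).
  exact: (measurableT_comp (@oppr_measurable R _)).
have k0 i j u : 0 <= k i j u by rewrite mulr_ge0//; case: ifP => _ //; exact: expR_ge0.
have v0 u : 0 <= v u by rewrite mulr_ge0// expR_ge0.
pose ck i (j : 'I_n) := if j == i then 2 `^ r^-1 * z else z.
have kE i j : (\int[leb]_u (k i j u)%:E = (ck i j)%:E)%E.
  rewrite /k /ck; case: ifPn => _; last by under eq_integral do rewrite mul1r.
  have h2 : 0 < 2^-1 :> R by rewrite invr_gt0.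
  rewrite (_ : 2 `^ r^-1 = 2^-1 `^ (- r^-1)); last first.
    by rewrite -[- _]mulN1r powRrM powR_inv1 ?(ltW h2)// invrK.
  rewrite -(integral_exp_density_scale r0 h2 zE); apply: eq_integral => u _.
  rewrite /w /exp_density mulrCA -expRD; congr (_ * expR _)%:E.
  by rewrite mulrC; field.
have vE : (\int[leb]_u (v u)%:E = (2 `^ (- r^-1) * z)%:E)%E.
  rewrite -(integral_exp_density_scale r0 _ zE)//; apply: eq_integral => u _.
  rewrite /v /w /exp_density mulrCA -expRD; congr (_ * expR _)%:E.
  by rewrite -opprD -mulr2n mulr_natl.
have b0 : 0 <= r^-1 `^ r^-1 by exact: powR_ge0.
have a0 : 0 <= a by exact: powR_ge0.
have mT1 := @measurable_prod_tuple n a (fun=> w) (fun=> mw).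
have mT2 i := measurable_prod_tuple (a * (r^-1 `^ r^-1 / n%:R)) (mk i).
have mT3 := @measurable_prod_tuple n (expR (c * n%:R)) (fun=> v) (fun=> mv).
have mT12 := emeasurable_funD mT1 (emeasurable_sum (index_enum 'I_n) mT2).
have ab0 : 0 <= a * (r^-1 `^ r^-1 / n%:R) by rewrite mulr_ge0// divr_ge0.
have T10 (x : n.-tuple R) : (0 <= (a * \prod_(i < n) w (tnth x i))%:E)%E.
  by rewrite lee_fin mulr_ge0 ?prodr_ge0.
have T20 i (x : n.-tuple R) : (0 <= (a * (r^-1 `^ r^-1 / n%:R) *
    \prod_(j < n) k i j (tnth x j))%:E)%E.
  by rewrite lee_fin mulr_ge0 ?prodr_ge0.
have T30 (x : n.-tuple R) : (0 <= (expR (c * n%:R) * \prod_(i < n) v (tnth x i))%:E)%E.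
  by rewrite lee_fin mulr_ge0 ?prodr_ge0 ?expR_ge0.
apply: (@le_trans _ _ (\int[lam n]_x ((a * \prod_(i < n) w (tnth x i))%:E +
  \sum_(i < n) (a * (r^-1 `^ r^-1 / n%:R) * \prod_(j < n) k i j (tnth x j))%:E +
  (expR (c * n%:R) * \prod_(i < n) v (tnth x i))%:E))%E).
  apply: ge0_le_integral => //.
  - move=> x _; rewrite patch_best_approx_radial// -EFinM lee_fin.
    by rewrite !mulr_ge0 ?prodr_ge0// ?best_approx_ge0// invr_ge0 lp_norm_ge0.
  - apply: emeasurable_funM.
      apply: measurable_radial_patch => //.
      by apply/measurable_EFinP; exact: measurable_best_approx_sup.
    by have := @measurable_prod_tuple n 1 (fun=> w) (fun=> mw);
      under eq_fun do rewrite mul1r.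
  - exact: emeasurable_funD mT12 mT3.
  move=> x _; rewrite patch_best_approx_radial// sumEFin -!EFinD -EFinM lee_fin.
  set P := \prod_(i < n) w (tnth x i); have P0 : 0 <= P by exact: prodr_ge0.
  have -> : \prod_(i < n) v (tnth x i) = expR (- \sum_(i < n) `|tnth x i| `^ r) * P.
    by rewrite big_split/= -sumrN expR_sum.
  rewrite [X in _ <= _ + X + _](_ : _ =
      a * (r^-1 `^ r^-1 / n%:R) * (\sum_(i < n) expR (`|tnth x i| `^ r / 2)) * P); last first.
    rewrite mulr_sumr mulr_suml; apply: eq_bigr => i _; rewrite -[RHS]mulrA; congr (_ * _).
    rewrite /k big_split/=; congr (_ * _); rewrite (bigD1 i)//= eqxx big1 ?mulr1// => j.
    by move/negbTE ->.
  rewrite [_ * (_ * P)]mulrA -!mulrDl ler_wpM2r// -expRD.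
  apply: (@le_trans _ _ (best_approx +oo m x / lp_norm r%:E x)).
    rewrite indicE; case: (x \in _); rewrite ?mul1r// mul0r divr_ge0//.
      exact: best_approx_ge0.
    exact: lp_norm_ge0.
  apply: le_trans (@best_approx_ratio_le n m r c x r0 c0 mn) _.
  by rewrite mulrDr mulr1 mulrA.
rewrite ge0_integralD//; last by move=> x _; rewrite adde_ge0// sume_ge0.
rewrite ge0_integralD//; last 2 first.
- by move=> x _; exact: sume_ge0.
- exact: (emeasurable_sum (index_enum 'I_n) mT2).
rewrite ge0_integral_sum//.
rewrite (@integral_prod_fin n a (fun=> w) (fun=> z))//.
rewrite (@integral_prod_fin n (expR (c * n%:R)) (fun=> v)
  (fun=> 2 `^ (- r^-1) * z)) ?expR_ge0//.
rewrite (eq_bigr (fun i => (a * (r^-1 `^ r^-1 / n%:R) * \prod_j ck i j)%:E)); last first.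
  by move=> i _; exact: (integral_prod_fin ab0 (mk i) (k0 i) (kE i)).
rewrite sumEFin -!EFinD -EFinM lee_fin !prodr_const !card_ord.
(* One of the n factors carries the extra 2 ^ (1/r); the n equal summands then cancel the 1 / n. *)
rewrite [X in _ + X + _ <= _](_ : _ =
    \sum_(i < n) (a * (r^-1 `^ r^-1 / n%:R) * (2 `^ r^-1 * z ^+ n))); last first.
  apply: eq_bigr => i _; congr (_ * _); rewrite (bigD1 i)//= /ck eqxx.
  rewrite (eq_bigr (fun=> z)) => [|j /negbTE ->//].
  by rewrite prodr_const cardC1 card_ord -mulrA -exprS prednK.
rewrite sumr_const card_ord -[(_ * _) *+ n]mulr_natr /K -/a exprMn  expRM_natr exprMn.
rewrite le_eqVlt; apply/orP; left; apply/eqP.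
by field; rewrite pnatr_eq0 -lt0n.
Qed.

End upper_bound.

(** * Lower bound *)

Section lower_bound.
Context {R : realType}.
Local Notation leb := (@lebesgue_measure R).

(** The Chernoff weight for having few large coordinates: over all coordinates the product is 2 to
    the power minus the number of those above s. *)
Let half_above (s u : R) : R := 1 - 2^-1 * \1_(`]s, +oo[%classic : set R) u.

Let half_aboveE s u : half_above s u = if s < u then 2^-1 else 1.
Proof.
rewrite /half_above indicE; case: ifPn => su.
  by rewrite mem_set ?mulr1; [lra|rewrite /= in_itv/= su].
by rewrite memNset ?mulr0 ?subr0//= in_itv/= andbT; exact/negP.
Qed.

Let half_above_ge0 s u : 0 <= half_above s u.
Proof. by rewrite half_aboveE; case: ifP. Qed.

Let measurable_half_above s : measurable_fun setT (half_above s).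
Proof.
apply: measurable_funB => //; exact: measurable_funM.
Qed.

Let prod_half_above n s (x : n.-tuple R) :
  \prod_(i < n) half_above s (tnth x i) = 2 ^- #|[pred i | (s < tnth x i)%R]|.
Proof.
rewrite (eq_bigr _ (fun i _ => half_aboveE s (tnth x i))) -big_mkcond/=.
by rewrite prodr_const exprVn.
Qed.

(** Half of the mass above s is removed, and that mass is at least q. Finiteness follows from [G] +
    [I] / 2 = z, as z is finite. *)
Let integral_half_above (w : R -> R) (z s q : R) :
  measurable_fun setT w -> (forall u, 0 <= w u) ->
  (\int[leb]_u (w u)%:E = z%:E)%E ->
  (q%:E <= \int[leb]_u (\1_(`]s, +oo[%classic : set R) u * w u)%:E)%E ->
  exists2 g, 0 <= g <= z - q / 2 &
    (\int[leb]_u (half_above s u * w u)%:E = g%:E)%E.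
Proof.
move=> mw w0 zE qle; set I := (\int[leb]_u _)%E in qle.
set G := (\int[leb]_u (half_above s u * w u)%:E)%E.
have mi : measurable_fun setT (\1_(`]s, +oo[%classic : set R) : R -> R).
  exact: measurable_indic.
have I0 : (0 <= I)%E by apply: integral_ge0 => u _; rewrite lee_fin mulr_ge0.
have G0 : (0 <= G)%E by apply: integral_ge0 => u _; rewrite lee_fin mulr_ge0.
have : (G + (2^-1)%:E * I = z%:E)%E.
  rewrite -zE -ge0_integralZl//; last 2 first.
  - by apply/measurable_EFinP; exact: measurable_funM.
  - by move=> u _; rewrite lee_fin mulr_ge0.
  rewrite -ge0_integralD//; last 4 first.
  - by move=> u _; rewrite lee_fin mulr_ge0.
  - by apply/measurable_EFinP; exact: measurable_funM (measurable_half_above s) mw.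
  - by move=> u _; rewrite -EFinM lee_fin !mulr_ge0.
  - by apply: measurable_funeM; apply/measurable_EFinP; exact: measurable_funM.
  by apply: eq_integral => u _; rewrite -EFinM -EFinD /half_above; congr EFin; ring.
clearbody G I; move: G0 I0 qle.
case: G => [g||]; case: I => [i||]//=; rewrite ?lee_fin => g0 i0 qi.
- move=> [giz]; exists g => //; rewrite g0/=; lra.
- by rewrite mulry gtr0_sg// mul1e.
- by rewrite mulry gtr0_sg// mul1e.
Qed.

(* For [x] in the orthant, either at most [m] coordinates exceed [s], and the
   product with the factors 1/2 is at least [2 ^ - m]; or [x] has norm larger
   than [M]; or the [m]-term error of [x] is at least [s]. *)
Lemma avg_width_ge (p : \bar R) (p0 : (0 < p)%E) (w v : R -> R)
    (z s M q k al be : R) n m :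
  cone_density p0 w z -> 0 < z -> (0 < n)%N -> 0 < s -> 0 < M ->
  (q%:E <= \int[leb]_u (\1_(`]s, +oo[%classic : set R) u * w u)%:E)%E ->
  measurable_fun setT v -> (forall u, 0 <= v u) ->
  (\int[leb]_u (v u)%:E = k%:E)%E ->
  (forall x : n.-tuple R, orthant x -> M < lp_norm p x ->
    \prod_(i < n) w (tnth x i) <= \prod_(i < n) v (tnth x i)) ->
  2 ^+ m * (z - q / 2) ^+ n <= al * z ^+ n -> k ^+ n <= be * z ^+ n ->
  ((s / M * (1 - al - be))%:E <= avg_width p +oo m (cone_measure p0 n))%E.
Proof.
move=> [mw [w0 wN] zE rep] z0 n0 s0 M0 qle mv v0 vE wv hal hbe.
have zn0 : 0 < z ^+ n by rewrite exprn_gt0.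
have [g /andP[g0 gz] gE] := integral_half_above mw w0 zE qle.
rewrite -(@lee_pmul2l _ (z ^+ n)%:E)// (rep _ (EFin \o best_approx +oo m))//; last 2 first.
- by apply/measurable_EFinP; exact: measurable_best_approx_sup.
- by move=> x; rewrite lee_fin best_approx_ge0.
set J := (\int[_]_x _)%E.
have sM : 0 <= s / M by rewrite divr_ge0// ltW.
have s2M : 0 <= s / M * 2 ^+ m by rewrite mulr_ge0.
pose gw u := half_above s u * w u.
have gw0 u : 0 <= gw u by rewrite mulr_ge0.
have mgw : measurable_fun setT gw by exact: measurable_funM (measurable_half_above s) mw.
have mT1 := @measurable_prod_tuple R n (s / M * 2 ^+ m) (fun=> gw) (fun=> mgw).
have mT2 := @measurable_prod_tuple R n (s / M) (fun=> v) (fun=> mv).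
have mT0 := @measurable_prod_tuple R n (s / M) (fun=> w) (fun=> mw).
pose h (x : n.-tuple R) := (((EFin \o best_approx +oo m) \_ (lp_sphere_pos p n))
  (radial p x) * (\prod_(i < n) w (tnth x i))%:E)%E.
have h0 x : (0 <= h x)%E.
  rewrite /h patch_best_approx_radial// -EFinM lee_fin.
  by rewrite !mulr_ge0 ?prodr_ge0// ?best_approx_ge0// invr_ge0 lp_norm_ge0.
have mh : measurable_fun setT h.
  apply: emeasurable_funM.
    apply: measurable_radial_patch => //.
    by apply/measurable_EFinP; exact: measurable_best_approx_sup.
  by have := @measurable_prod_tuple R n 1 (fun=> w) (fun=> mw);
    under eq_fun do rewrite mul1r.
have T10 (x : n.-tuple R) : (0 <= (s / M * 2 ^+ m * \prod_(i < n) gw (tnth x i))%:E)%E.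
  by rewrite lee_fin mulr_ge0 ?prodr_ge0.
have T20 (x : n.-tuple R) : (0 <= (s / M * \prod_(i < n) v (tnth x i))%:E)%E.
  by rewrite lee_fin mulr_ge0 ?prodr_ge0.
(* The left side is s / M times the total mass, [J] is z ^ n times the width, and the rest bounds
   the two bad events; [al] and [be] measure these relative to z ^ n. *)
have key : ((s / M * z ^+ n)%:E <=
    J + (s / M * 2 ^+ m * g ^+ n + s / M * k ^+ n)%:E)%E.
  have := @integral_prod_fin R n (s / M) (fun=> w) (fun=> z) sM
    (fun=> mw) (fun=> w0) (fun=> zE).
  have := @integral_prod_fin R n (s / M * 2 ^+ m) (fun=> gw) (fun=> g) s2M
    (fun=> mgw) (fun=> gw0) (fun=> gE).
  have := @integral_prod_fin R n (s / M) (fun=> v) (fun=> k) sM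
    (fun=> mv) (fun=> v0) (fun=> vE).
  rewrite !prodr_const !card_ord EFinD => <- <- <-.
  rewrite -ge0_integralD// -ge0_integralD//; last 3 first.
  - by move=> x _; exact: h0.
  - by move=> x _; rewrite adde_ge0.
  - exact: emeasurable_funD.
  apply: ge0_le_integral => //.
  - by move=> x _; rewrite lee_fin mulr_ge0 ?prodr_ge0.
  - by apply: emeasurable_funD => //; exact: emeasurable_funD.
  move=> x _; rewrite -/(h x).
  set W := \prod_(i < n) w (tnth x i); have W0 : 0 <= W by exact: prodr_ge0.
  (* Off the orthant some coordinate is negative, where [w] vanishes, so the left side is 0. *)
  have [xO|/existsNP[i xi]] := pselect (orthant x); last first.
    rewrite [W](_ : _ = 0) ?mulr0 ?adde_ge0//.
    by rewrite /W (bigD1 i)//= wN ?mul0r// ltNge; apply/negP.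
  have gwE : \prod_(i < n) gw (tnth x i) = 2 ^- #|[pred i | (s < `|tnth x i|)%R]| * W.
    rewrite big_split/= prod_half_above; congr (2 ^- _ * _).
    by apply: eq_card => i; rewrite !inE ger0_norm.
  have T1x := T10 x; have T2x := T20 x; rewrite !gwE in T1x *.
  set c := #|_| in T1x *; have [cm|mc] := leqP c m.
    rewrite -[leLHS]add0e leeD// -[leLHS]adde0 leeD// lee_fin.
    rewrite -[leRHS]mulrA ler_wpM2l// mulrA -[leLHS]mul1r ler_wpM2r//.
    by rewrite ler_pdivlMr ?exprn_gt0// mul1r ler_weXn2l// ler1n.
  have [Mx|xM] := ltP M (lp_norm p x).
    rewrite -[leLHS]add0e leeD// -[leLHS]add0e leeD// lee_fin.
    by rewrite ler_wpM2l// wv.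
  rewrite -[leLHS]adde0 leeD ?adde_ge0//.
  rewrite /h patch_best_approx_radial// -EFinM lee_fin indicE mem_set// mul1r.
  rewrite ler_wpM2r//.
  have st : s < best_approx +oo m x by rewrite ltNge best_approx_sup_le ?ltW// -ltnNge.
  have x0 : 0 < lp_norm p x.
    by rewrite (lt_le_trans s0)// (le_trans (ltW st))// best_approx_sup_le_lp.
  by rewrite ler_pM ?invr_ge0 ?(ltW s0) ?(ltW M0) ?(ltW st)// lef_pV2 ?posrE.
move: key; rewrite -leeBlDr// => key; apply: le_trans key; rewrite -EFinM -EFinB lee_fin.
have gn : g ^+ n <= (z - q / 2) ^+ n by rewrite lerXn2r// nnegrE (le_trans g0).
have : 2 ^+ m * g ^+ n <= al * z ^+ n by apply: le_trans hal; rewrite ler_wpM2l.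
move=> {}hal; set A := s / M in sM *.
rewrite [leLHS](_ : _ = A * (z ^+ n * (1 - al - be))); last by ring.
rewrite [leRHS](_ : _ = A * (z ^+ n - 2 ^+ m * g ^+ n - k ^+ n)); last by ring.
by rewrite ler_wpM2l//; lra.
Qed.

End lower_bound.

(** * Rates *)

Section rates.
Context {R : realType}.
Local Notation leb := (@lebesgue_measure R).

Lemma powR_expR (a x : R) : 0 < a -> a `^ x = expR (x * ln a).
Proof. by move=> a0; rewrite mulrC expRM lnK. Qed.

Lemma avg_width_le_rate (r : R) (p0 : (0 < r%:E)%E) :
  exists2 C : R, 0 < C & forall n m, (m < n)%N ->
  (avg_width r%:E +oo m (cone_measure p0 n) <=
   (C * (ln (expR 1 * n%:R / m.+1%:R) / n%:R) `^ r^-1)%:E)%E.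
Proof.
have r0 : 0 < r by rewrite -lte_fin.
have [z z0 zE] := integral_exp_density r0.
have ln2 : 0 < ln 2 :> R by rewrite ln_gt0// ltr1n.
have b0 : 0 < r^-1 by rewrite invr_gt0.
(* Half of the decay rate ln 2 / r: then exp (c) 2 ^ (-1/r) = exp (- c), so the Chernoff term is exp
   (- c n). *)
have [c cE] : exists c, c = r^-1 * ln 2 / 2 by exists (r^-1 * ln 2 / 2).
have c0 : 0 < c by rewrite cE divr_gt0// mulr_gt0.
exists ((2 / c) `^ r^-1 * (1 + r^-1 `^ r^-1 * 2 `^ r^-1) + (2 / ln 2) `^ r^-1).
  by rewrite ltr_wpDl ?powR_gt0 ?divr_gt0// mulr_ge0 ?powR_ge0// addr_ge0// mulr_ge0 ?powR_ge0.
move=> n m mn; apply: le_trans (avg_width_le_exp p0 r0 c0 z0 zE mn) _.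
set L := ln _; have L1 : 1 <= L by exact: ln_ratio_ge1.
have n0 : 0 < n%:R :> R by rewrite ltr0n (leq_ltn_trans _ mn).
rewrite lee_fin [leRHS]mulrDl; apply: lerD.
  rewrite le_eqVlt; apply/orP; left; apply/eqP.
  rewrite [RHS]mulrAC; congr (_ * _).
  rewrite -powRM ?divr_ge0 ?(ltW c0) ?(ltW n0) ?(le_trans _ L1)//.
  by congr (_ `^ _); field; rewrite !gt_eqF.
rewrite powR_expR// -expRD -expRM_natr.
rewrite (_ : _ * n%:R = - (n%:R * ln 2 / 2) * r^-1); last by rewrite cE; field; rewrite gt_eqF.
rewrite expRM -powRM ?divr_ge0 ?(ltW ln2) ?(ltW n0) ?(le_trans _ L1)//.
apply: ler_powR2r; rewrite ?expR_ge0 ?(ltW b0)//.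
(* Here exp (- c n) is the power 1/r of exp (- y), and exp (- y) <= 1 / y; since L >= 1, this is at
   most a constant times L / n. *)
set y := n%:R * ln 2 / 2; have y0 : 0 < y by rewrite divr_gt0// mulr_gt0.
apply: (@le_trans _ _ y^-1).
  rewrite expRN lef_pV2 ?posrE ?expR_gt0//.
  by rewrite (le_trans _ (expR_ge1Dx y))// lerDr.
rewrite (_ : y^-1 = 2 / ln 2 * (1 / n%:R)); last by rewrite /y; field; rewrite !gt_eqF.
by rewrite ler_wpM2l ?divr_ge0 ?(ltW ln2)// ler_wpM2r// invr_ge0 ltW.
Qed.

(** Only the interval from s to 2 s is kept; it has length s and the density there is at least its
    value at 2 s. *)
Lemma integral_exp_density_above (r s : R) : 0 < r -> 0 < s ->
  ((s * expR (- (2 * s) `^ r))%:E <=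
   \int[leb]_u (\1_(`]s, +oo[%classic : set R) u * exp_density r u)%:E)%E.
Proof.
move=> r0 s0.
have mE : measurable_fun [set: R] (fun u =>
    (\1_(`]s, +oo[%classic : set R) u * exp_density r u)%:E).
  apply/measurable_EFinP; apply: measurable_funM; first exact: measurable_indic.
  exact: measurable_exp_density.
have E0 u : (0 <= (\1_(`]s, +oo[%classic : set R) u * exp_density r u)%:E)%E.
  by rewrite lee_fin mulr_ge0// exp_density_ge0.
set e := expR (- (2 * s) `^ r).
pose D : set R := `]s, 2 * s]%classic.
apply: (@le_trans _ _ (\int[leb]_(u in D) e%:E)%E).
  rewrite /D integral_cst//= lebesgue_measure_itv/= lte_fin ifT; last by lra.
  by rewrite -EFinB -EFinM lee_fin mulrC (_ : 2 * s - s = s)//; lra.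
apply: (@le_trans _ _ (\int[leb]_(u in D)
    (\1_(`]s, +oo[%classic : set R) u * exp_density r u)%:E)%E); last first.
  by apply: ge0_subset_integral => //; exact: measurable_itv.
have mD : measurable D by exact: measurable_itv.
have mED : measurable_fun D (fun u =>
    (\1_(`]s, +oo[%classic : set R) u * exp_density r u)%:E).
  exact: measurable_funTS.
apply: ge0_le_integral => //.
  by move=> u _; rewrite lee_fin expR_ge0.
move=> u; rewrite /D /= in_itv/= => /andP[su us].
have u0 : 0 < u by exact: lt_trans su.
rewrite lee_fin /exp_density !indicE !mem_set/= ?in_itv/= ?su ?(ltW u0)// !mul1r.
by rewrite /e ler_expR lerN2 gtr0_norm// ler_powR2r// ltW.
Qed.

Lemma cone_measure_sphere (p : \bar R) (p0 : (0 < p)%E) n : (0 < n)%N ->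
  cone_measure p0 n (lp_sphere_pos p n) = 1%E.
Proof.
move=> n0; rewrite -(cone_measureT p0 n0) /cone_measure.
by rewrite setIid setTI.
Qed.

(* Covers the small [n], for which [m <= eps * n] forces [m = 0]. *)
Lemma avg_width0_ge (r : R) (p0 : (0 < r%:E)%E) n : (0 < n)%N ->
  ((n%:R^-1 `^ r^-1)%:E <= avg_width r%:E +oo 0 (cone_measure p0 n))%E.
Proof.
move=> n0; have r0 : 0 < r by rewrite -lte_fin.
have n0' : 0 < n%:R :> R by rewrite ltr0n.
have mS := @measurable_lp_sphere_pos R _ p0 n.
rewrite -[leLHS]mule1 -(cone_measure_sphere p0 n0) -integral_cst//.
apply: ge0_le_integral => //.
- by move=> x _; rewrite lee_fin powR_ge0.
- by apply: measurable_funTS; apply/measurable_EFinP; exact: measurable_best_approx_sup.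
move=> x [x0 /= x1]; rewrite lee_fin; set t := best_approx _ _ _.
have t0 : 0 <= t by exact: best_approx_ge0.
rewrite [leRHS](_ : t = (t `^ r) `^ r^-1); last by rewrite -powRrM mulfV ?gt_eqF// powRr1.
apply: ler_powR2r; rewrite ?invr_ge0 ?(ltW r0) ?(ltW n0')//.
rewrite -div1r ler_pdivrMr// -[leLHS]x1.
apply: (@le_trans _ _ (\sum_(i < n) t `^ r)); last first.
  by rewrite sumr_const card_ord mulr_natr.
apply: ler_sum => i _; apply: ler_powR2r => //; first exact: ltW.
by rewrite (le_trans (ler_norm _))// le_best_approx_sup0.
Qed.

Lemma expR1_ge_two : 2 <= expR 1 :> R.
Proof. by have := expR_ge1Dx (1 : R); lra. Qed.

(** The hypothesis asks for an expected count of at least 4 (m+1). As 1 - y <= exp (- y) and 2 <= e,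
    the left side is at most z ^ n exp (m - 2 (m+1)), hence at most z ^ n exp (- 2). *)
Lemma two_exprn_sub_le (z q : R) n m : 0 < z -> q <= z ->
  4 * m.+1%:R <= q * n%:R / z ->
  2 ^+ m * (z - q / 2) ^+ n <= 4^-1 * z ^+ n.
Proof.
move=> z0 qz qn; have e2 := expR1_ge_two.
have zq0 : 0 <= z - q / 2 by lra.
have zq : z - q / 2 <= z * expR (- (q / z / 2)).
  apply: (@le_trans _ _ (z * (1 + - (q / z / 2)))).
    by rewrite le_eqVlt; apply/orP; left; apply/eqP; field; rewrite gt_eqF.
  by rewrite ler_wpM2l ?expR_ge1Dx// ltW.
apply: (@le_trans _ _ (expR m%:R * (z ^+ n * expR (- (2 * m.+1%:R))))).
  rewrite ler_pM ?exprn_ge0//.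
    by rewrite -[m%:R]mulr1 expRM_natl lerXn2r// nnegrE// expR_ge0.
  apply: (@le_trans _ _ ((z * expR (- (q / z / 2))) ^+ n)).
    by rewrite lerXn2r// nnegrE mulr_ge0 ?expR_ge0// ltW.
  rewrite exprMn ler_wpM2l ?exprn_ge0 ?(ltW z0)// -expRM_natr ler_expR.
  rewrite (_ : _ * n%:R = - ((q * n%:R / z) / 2)); last by field; rewrite gt_eqF.
  by lra.
rewrite mulrCA mulrC ler_wpM2r ?exprn_ge0 ?(ltW z0)// -expRD.
apply: (@le_trans _ _ (expR (- 2))).
  by rewrite ler_expR -natr1; have := ler0n R m; lra.
rewrite expRN lef_pV2 ?posrE ?expR_gt0// (_ : expR 2 = expR 1 ^+ 2) ?expr2; first by nra.
by rewrite -expr2 -expRM_natr mul1r.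
Qed.

Lemma avg_width_ge_exp (r z : R) (p0 : (0 < r%:E)%E) n m : 0 < r -> 0 < z ->
  (\int[leb]_u (exp_density r u)%:E = z%:E)%E ->
  let a := 2 `^ (- r) / 2 in
  (2 <= n)%N -> (m < n)%N ->
  (1 + (4 * z * expR 1 / a `^ r^-1) ^+ 2) * m.+1%:R <= n%:R ->
  ((2^-1 * (a / (2 * ln 2 * (1 + r^-1))) `^ r^-1 *
     (ln (expR 1 * n%:R / m.+1%:R) / n%:R) `^ r^-1)%:E <=
   avg_width r%:E +oo m (cone_measure p0 n))%E.
Proof.
move=> r0 z0 zE a n2 mn Dn; set L := ln (expR 1 * n%:R / _).
have n0 : (0 < n)%N by exact: leq_trans n2.
have n0' : 0 < n%:R :> R by rewrite ltr0n.
have L1 : 1 <= L by exact: ln_ratio_ge1.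
have L0 : 0 < L by rewrite (lt_le_trans _ L1).
have b0 : 0 < r^-1 by rewrite invr_gt0.
have a0 : 0 < a by rewrite divr_gt0// powR_gt0.
have ln2 : 0 < ln 2 :> R by rewrite ln_gt0// ltr1n.
(* Chosen so that exp (- K / 2) 2 ^ (1/r) = 1/2: the tilted density [v] below then has integral z /
   2. *)
have [K KE] : exists K : R, K = 2 * ln 2 * (1 + r^-1) by exists (2 * ln 2 * (1 + r^-1)).
have K0 : 0 < K by rewrite KE !mulr_gt0// addr_gt0.
rewrite -KE; set s := (a * L) `^ r^-1; set M := (K * n%:R) `^ r^-1.
have s0 : 0 < s by rewrite powR_gt0// mulr_gt0.
have M0 : 0 < M by rewrite powR_gt0// mulr_gt0.
have s2 : (2 * s) `^ r = L / 2.
  rewrite powRM ?(ltW s0)// /s -powRrM mulVf ?gt_eqF// powRr1 ?mulr_ge0 ?(ltW a0) ?(ltW L0)//.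
  by rewrite /a powRN; field; rewrite gt_eqF// powR_gt0.
set w := exp_density r.
pose q := s * expR (- (2 * s) `^ r).
have qle := integral_exp_density_above r0 s0.
have mw : measurable_fun setT w by exact: measurable_exp_density.
have w0 u : 0 <= w u by exact: exp_density_ge0.
have qz : q <= z.
  rewrite -lee_fin -zE (le_trans qle)//; apply: ge0_le_integral => //.
  - by move=> u _; rewrite lee_fin mulr_ge0.
  - apply/measurable_EFinP; apply: measurable_funM => //; exact: measurable_indic.
  - exact/measurable_EFinP.
  move=> u _; rewrite lee_fin indicE.
  by case: (_ \in _); rewrite ?mul1r// mul0r.
pose v u := expR (- (K / 2)) *
  (\1_(`[0, +oo[%classic : set R) u * expR (- (2^-1 * `|u| `^ r))).
have vw u : v u = expR ((`|u| `^ r - K) / 2) * w u.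
  rewrite /v /w /exp_density mulrCA [RHS]mulrCA -!expRD; congr (_ * expR _).
  by field.
have v0 u : 0 <= v u by rewrite vw mulr_ge0// expR_ge0.
have mv' : measurable_fun setT (fun u : R =>
    \1_(`[0, +oo[%classic : set R) u * expR (- (2^-1 * `|u| `^ r))).
  apply: measurable_funM; first exact: measurable_indic.
  apply: (measurableT_comp (@measurable_expR R)).
  apply: (measurableT_comp (@oppr_measurable R _)); apply: measurable_funM => //.
  by apply: (measurableT_comp (measurable_powR _)); exact: normr_measurable.
have mv : measurable_fun setT v by exact: measurable_funM.
have vE : (\int[leb]_u (v u)%:E = (z / 2)%:E)%E.
  under eq_integral do rewrite EFinM.
  rewrite ge0_integralZl ?lee_fin ?expR_ge0//; last exact/measurable_EFinP.
  rewrite (integral_exp_density_scale r0 _ zE) ?invr_gt0// -EFinM; congr EFin.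
  rewrite mulrA [RHS]mulrC; congr (_ * _).
  have e2 : expR (- ln 2) = 2^-1 :> R by rewrite expRN lnK// posrE.
  by rewrite -[X in X `^ _]e2 -[RHS]e2 -expRM -expRD KE; congr expR; field; rewrite gt_eqF.
have wv (x : n.-tuple R) : orthant x -> M < lp_norm r%:E x ->
    \prod_(i < n) w (tnth x i) <= \prod_(i < n) v (tnth x i).
  move=> _ Mx; set N := \sum_(i < n) `|tnth x i| `^ r.
  have NK : K * n%:R <= N.
    rewrite leNgt; apply/negP => NK; move: Mx; apply/negP; rewrite -leNgt /M /=.
    apply: ler_powR2r; [exact: ltW|by apply: sumr_ge0 => i _; exact: powR_ge0|exact: ltW].
  rewrite [leRHS](eq_bigr _ (fun i _ => vw (tnth x i))) [leRHS]big_split/= -expR_sum.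
  rewrite -[leLHS]mul1r ler_wpM2r ?prodr_ge0// -[leLHS]expR0 ler_expR.
  by rewrite -mulr_suml divr_ge0// sumrB sumr_const card_ord -mulr_natr subr_ge0.
(* Since n = (m+1) exp (L - 1), the expected count q n / z is (m+1) exp (L / 2) s / (e z). It is at
   least 4 (m+1) because s >= a ^ (1/r) and exp (L / 2) >= [T], the latter by the assumed size of n
   / (m+1). *)
have hal : 2 ^+ m * (z - q / 2) ^+ n <= 4^-1 * z ^+ n.
  apply: two_exprn_sub_le => //; rewrite ler_pdivlMr// /q s2.
  set T := 4 * z * expR 1 / a `^ r^-1 in Dn.
  have ab0 : 0 < a `^ r^-1 by rewrite powR_gt0.
  have T0 : 0 < T by rewrite divr_gt0// !mulr_gt0// expR_gt0.
  have nE : n%:R = m.+1%:R * expR (L - 1).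
    rewrite expRD expRN /L lnK ?posrE ?divr_gt0 ?mulr_gt0 ?expR_gt0 ?ltr0n//.
    by field; rewrite !gt_eqF ?expR_gt0.
  have TL : T <= expR (L / 2).
    rewrite -(@ler_pXn2r _ 2)// ?nnegrE ?expR_ge0 ?(ltW T0)// -expRM_natr divfK//.
    have Tn : T ^+ 2 * m.+1%:R <= n%:R.
      by apply: le_trans Dn; rewrite ler_wpM2r// lerDr.
    rewrite -(@ler_pM2r _ m.+1%:R) ?ltr0n// (le_trans Tn)// nE mulrC.
    by rewrite ler_wpM2r// ler_expR; lra.
  have sa : a `^ r^-1 <= s.
    by apply: ler_powR2r; rewrite ?(ltW b0) ?(ltW a0)// ler_peMr// ltW.
  rewrite (_ : 4 * m.+1%:R * z = m.+1%:R / expR 1 * (T * a `^ r^-1)); last first.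
    by rewrite /T; field; rewrite !gt_eqF ?expR_gt0.
  rewrite (_ : s * expR (- (L / 2)) * n%:R =
      m.+1%:R / expR 1 * (expR (L / 2) * s)); last first.
    rewrite nE (_ : expR (L - 1) = expR (L / 2) * expR (L / 2) / expR 1).
      by rewrite expRN; field; rewrite !gt_eqF ?expR_gt0.
    by rewrite -expRD -expRB; congr expR; field.
  by rewrite ler_wpM2l ?divr_ge0 ?expR_ge0// ler_pM ?(ltW T0) ?(ltW ab0).
(* This is where n >= 2 matters: 2 ^ (- n) <= 1/4. *)
have hbe : (z / 2) ^+ n <= 4^-1 * z ^+ n.
  rewrite exprMn mulrC ler_wpM2r ?exprn_ge0 ?(ltW z0)//.
  rewrite (_ : 4^-1 = 2^-1 ^+ 2 :> R); last by rewrite exprVn -natrX.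
  by rewrite ler_wiXn2l//; lra.
have := avg_width_ge (cone_density_exp p0 zE) z0 n0 s0 M0 qle mv v0 vE wv hal hbe.
rewrite [X in (X%:E <= _)%E](_ : _ =
    2^-1 * (a / K) `^ r^-1 * (L / n%:R) `^ r^-1)//.
rewrite -[RHS]mulrA -powRM ?divr_ge0 ?(ltW a0) ?(ltW K0) ?(ltW L0) ?(ltW n0')//.
rewrite [LHS]mulrC (_ : 1 - 4^-1 - 4^-1 = 2^-1); last by field.
congr (_ * _); rewrite /s /M (_ : a / K * (L / n%:R) = a * L * (K * n%:R)^-1); last first.
  by field; rewrite !gt_eqF.
have Kn0 : 0 < K * n%:R by rewrite mulr_gt0.
have aL0 : 0 < a * L by rewrite mulr_gt0.
rewrite [RHS]powRM ?invr_ge0 ?(ltW Kn0) ?(ltW aL0)//; congr (_ * _).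
by rewrite -powR_inv1 ?powR_ge0// powRAC powR_inv1// ltW.
Qed.

Lemma avg_width_ge_rate (r : R) (p0 : (0 < r%:E)%E) :
  exists eps C : R, [/\ 0 < eps, eps < 1, 0 < C & forall n m,
  (2 <= n)%N -> m%:R <= eps * n%:R ->
  ((C * (ln (expR 1 * n%:R / m.+1%:R) / n%:R) `^ r^-1)%:E <=
   avg_width r%:E +oo m (cone_measure p0 n))%E].
Proof.
have r0 : 0 < r by rewrite -lte_fin.
have b0 : 0 < r^-1 by rewrite invr_gt0.
have [z z0 zE] := integral_exp_density r0.
pose a : R := 2 `^ (- r) / 2.
have a0 : 0 < a by rewrite divr_gt0// powR_gt0.
have ln2 : 0 < ln 2 :> R by rewrite ln_gt0// ltr1n.
have [D DE] : exists D, D = 1 + (4 * z * expR 1 / a `^ r^-1) ^+ 2 by eexists.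
have D1 : 1 <= D by rewrite DE lerDl sqr_ge0.
have D0 : 0 < D by rewrite (lt_le_trans _ D1).
pose C1 := 2^-1 * (a / (2 * ln 2 * (1 + r^-1))) `^ r^-1.
have C10 : 0 < C1 by rewrite mulr_gt0// powR_gt0// divr_gt0// !mulr_gt0// addr_gt0.
have lnD : 1 <= ln (expR 1 * D).
  by rewrite lnM ?posrE ?expR_gt0// expRK lerDl ln_ge0.
have lnD0 : 0 < ln (expR 1 * D) by rewrite (lt_le_trans _ lnD).
pose C2 := (ln (expR 1 * D))^-1 `^ r^-1.
have C20 : 0 < C2 by rewrite powR_gt0// invr_gt0.
(* [C1] serves the range D (m+1) <= n. The factor 2 in eps ensures that only m = 0 escapes it: for m
   >= 1, D (m+1) <= 2 D m <= n. [C2] serves m = 0 and n < D, where ln (e n) <= ln (e D). *)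
exists (2 * D)^-1, (Num.min C1 C2); split.
- by rewrite invr_gt0 mulr_gt0.
- by rewrite invf_lt1; lra.
- by rewrite lt_min C10.
move=> n m n2 mn.
have n0 : (0 < n)%N by exact: leq_trans n2.
have n0' : 0 < n%:R :> R by rewrite ltr0n.
have {}mn : 2 * D * m%:R <= n%:R by move: mn; rewrite mulrC ler_pdivlMr ?mulr_gt0// mulrC.
have mltn : (m < n)%N.
  rewrite -(ltr_nat R); case: m mn => [|m mn]//.
  by rewrite (lt_le_trans _ mn)// ltr_pMl ?ltr0n//; lra.
have [Dn|nD] := leP (D * m.+1%:R) n%:R.
  apply: le_trans (avg_width_ge_exp p0 r0 z0 zE n2 mltn _); last by rewrite -/a -DE.
  by rewrite lee_fin -/a -/C1 ler_wpM2r ?powR_ge0// ge_min lexx.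
have m0 : m = 0%N.
  case: m mn nD {mltn} => // m mn; rewrite ltNge => /negP[]; apply: le_trans mn.
  have m1 : 1 <= m.+1%:R :> R by rewrite ler1n.
  by rewrite -[m.+2%:R]natr1; nra.
rewrite {}m0 in nD *; rewrite mulr1 in nD.
apply: le_trans (avg_width0_ge p0 n0); rewrite lee_fin divr1.
apply: (@le_trans _ _ (C2 * (ln (expR 1 * D) / n%:R) `^ r^-1)).
  rewrite ler_pM ?powR_ge0 ?le_min ?(ltW C10) ?(ltW C20)// ?ge_min ?lexx ?orbT//.
  apply: ler_powR2r; rewrite ?(ltW b0)//.
    rewrite divr_ge0 ?(ltW n0')// ln_ge0// -[leLHS]mulr1 ler_pM ?ler1n//.
    by have := expR1_ge_two; lra.
  rewrite ler_wpM2r ?invr_ge0 ?(ltW n0')// ler_ln ?posrE ?mulr_gt0 ?expR_gt0//.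
  by rewrite ler_wpM2l ?expR_ge0// ltW.
by rewrite -powRM ?divr_ge0 ?invr_ge0 ?(ltW lnD0) ?(ltW n0')// mulrA mulVf ?gt_eqF// mul1r.
Qed.

(** Taken with s = 1/2 and M = 1: the uniform density vanishes where the norm exceeds 1, so [v] = 0
    and that bad event costs nothing. The other one has probability at most 3/4, and 1/2 (1 - 3/4) =
    1/8. *)
Lemma avg_width_sup_ge (p0 : (0 < +oo :> \bar R)%E) n m :
  (2 <= n)%N -> m%:R <= 8^-1 * n%:R :> R ->
  ((8^-1)%:E <= avg_width +oo +oo m (cone_measure p0 n))%E.
Proof.
move=> n2 mn; have n0 : (0 < n)%N by exact: leq_trans n2.
have h2 : 0 < 2^-1 :> R by rewrite invr_gt0.
pose w : R -> R := \1_(`[0, 1]%classic : set R).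
have qle : ((2^-1)%:E <= \int[leb]_u (\1_(`]2^-1, +oo[%classic : set R) u * w u)%:E)%E.
  rewrite (_ : (fun u => _) = EFin \o (\1_(`]2^-1, 1]%classic : set R) : R -> R)).
    rewrite integral_indic//= setIT lebesgue_measure_itv/= lte_fin ifT; last by lra.
    by rewrite -EFinB lee_fin; lra.
  apply/funext => u; rewrite /w /= !indicE -natrM mulnb; congr ((_ : bool)%:R)%:E.
  apply/andP/idP; rewrite !inE/= !in_itv/=.
    by move=> [/andP[-> _] /andP[_ ->]].
  by move=> /andP[hu u1]; rewrite hu u1 andbT (le_trans (ltW h2))// ltW.
(* Four factors 3/4 absorb each factor 2, as 2 (3/4) ^ 4 < 1; the spare factor 3/4 keeps the
   probability below 1 when m = 0. *)
have mle : (4 * m + 1 <= n)%N.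
  have : (8 * m <= n)%N.
    by rewrite -(ler_nat R) natrM; lra.
  case: m mn {qle} => // m _ H; apply: leq_trans H; rewrite !mulnS; lia.
have num : 2 ^+ m * (1 - 2^-1 / 2) ^+ n <= 3 / 4 * 1 ^+ n :> R.
  rewrite expr1n mulr1 (_ : 1 - 2^-1 / 2 = 3 / 4 :> R); last by field.
  apply: (@le_trans _ _ (2 ^+ m * (3 / 4) ^+ (4 * m + 1))).
    by rewrite ler_wpM2l// ler_wiXn2l//; lra.
  rewrite exprD expr1 exprM mulrA -exprMn; apply: ler_piMl; first by lra.
  by apply: exprn_ile1; lra.
have := @avg_width_ge R _ p0 w (fun=> 0) 1 2^-1 1 2^-1 0 (3 / 4) 0 n m
  (cone_density_unif p0) ltr01 n0 h2 ltr01 qle (@measurable_cst _ _ _ _ _ _)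
  (fun=> lexx 0) _ _ num.
rewrite (_ : 2^-1 / 1 * (1 - 3 / 4 - 0) = 8^-1 :> R); last by field.
apply.
- by rewrite integral0.
- move=> x x0 x1; rewrite [leRHS]prodr_const card_ord expr0n gtn_eqF//=.
  rewrite /w prod_indic indicE memNset// => xI; move: x1; apply/negP; rewrite -leNgt.
  apply/bigmax_leP; split => // i _; have := xI i; rewrite /= in_itv/= => /andP[? ?].
  by rewrite ger0_norm.
- by rewrite expr0n gtn_eqF//= mul0r.
Qed.

End rates.

Theorem theorem7 (R : realType) (p : \bar R) (p0 : (0 < p)%E) :
  (exists2 C : R, 0 < C &
    forall n m : nat, (2 <= n)%N -> (m <= n - 1)%N ->
    (avg_width p +oo m (cone_measure p0 n) <=
      (C * (ln (expR 1 * n%:R / (m.+1)%:R) / n%:R) `^ fine (p^-1))%:E)%E) /\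
  (exists eps C : R, [/\ 0 < eps, eps < 1, 0 < C &
    forall n m : nat, (2 <= n)%N -> m%:R <= eps * n%:R ->
    ((C * (ln (expR 1 * n%:R / (m.+1)%:R) / n%:R) `^ fine (p^-1))%:E <=
      avg_width p +oo m (cone_measure p0 n))%E]).
Proof.
case: p p0 => [r p0|p0|//].
  have r0 : 0 < r by rewrite -lte_fin.
  rewrite inver gt_eqF//=; split; last exact: avg_width_ge_rate.
  have [C C0 H] := avg_width_le_rate p0; exists C => // n m n2 mn.
  by apply: H; rewrite (leq_ltn_trans mn)// subn1 prednK// (leq_trans _ n2).
(* For infinite p the exponent is 0 and the rate is the constant 1: the error is at most the norm,
   which is 1 on a sphere of total mass 1. *)
rewrite invey/=; split.
  exists 1 => // n m n2 _; rewrite powRr0 mulr1.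
  have n0 : (0 < n)%N by exact: leq_trans n2.
  have mS := @measurable_lp_sphere_pos R _ p0 n.
  rewrite -(cone_measure_sphere p0 n0) -[leRHS]mul1e -integral_cst//.
  apply: ge0_le_integral => //.
  - by move=> x _; rewrite lee_fin best_approx_ge0.
  - by apply: measurable_funTS; apply/measurable_EFinP; exact: measurable_best_approx_sup.
  move=> x; rewrite lp_sphere_posE// => -[_ x1]; rewrite lee_fin -x1.
  exact: best_approx_sup_le_lp.
exists 8^-1, 8^-1; split; rewrite ?invr_gt0 ?invf_lt1 ?ltr1n// => n m n2 mn.
by rewrite powRr0 mulr1; exact: avg_width_sup_ge.
Qed.
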